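(* Let $V\in\mathrm{Mod}(\mathcal U'_q(\hat{\mathfrak g}))$ and $v\in V\setminus\{0\}$. Then $\tilde V(v)=\mathcal U_q^u(\hat{\mathfrak g}).v$ is an $\mathcal A$-form of $\mathcal U'_q(\hat{\mathfrak g}).v$. Moreover $(\tilde V(v))_{u=1}=\tilde V(v)/((u-1)\tilde V(v))$ is an object of $\mathrm{Mod}(\mathcal U_q(\hat{\mathfrak g}))$ and is a non zero cyclic $\mathcal U_q(\hat{\mathfrak g})$-module generated by (the image of) $v$.
   Context: **Cartan data.** $C=(C_{i,j})_{1\le i,j\le n}$ is a symmetrizable generalized Cartan matrix ($C_{i,j}\in\mathbb Z$, $C_{i,i}=2$, $C_{i,j}\le 0$ for $i\neq j$, $C_{i,j}=0\Leftrightarrow C_{j,i}=0$), $I=\{1,\dots,n\}$, $D=\mathrm{diag}(r_1,\dots,r_n)$ with positive integers $r_i$ such that $B=DC$ is symmetric. $q\in\mathbb C^*$ is not a root of unity, with rational powers fixed compatibly ($q^{s+t}=q^sq^t$); $q_i=q^{r_i}$, $[l]_q=\frac{q^l-q^{-l}}{q-q^{-1}}$, and $\begin{bmatrix}s\\k\end{bmatrix}_{q_i}$ is the $q_i$-binomial coefficient. $(\mathfrak h,\{\alpha_i\},\{\alpha_i^\vee\})$ is a realization of $C$: $\mathfrak h$ is a $\mathbb Q$-vector space of dimension $2n-\mathrm{rank}(C)$, the $\alpha_i\in\mathfrak h^*$ and the $\alpha_i^\vee\in\mathfrak h$ are linearly independent families, $\alpha_j(\alpha_i^\vee)=C_{i,j}$.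 $Q^+=\sum_i\mathbb N\alpha_i$; for $\lambda\in\mathfrak h^*$, $\mathcal S(\lambda)=\lambda-Q^+$. **Quantum affinization.** $\mathcal U_q(\hat{\mathfrak g})$ is the $\mathbb C$-algebra with generators $x_{i,r}^{\pm}$ ($i\in I,r\in\mathbb Z$), $k_h$ ($h\in\mathfrak h$), $h_{i,m}$ ($i\in I,m\in\mathbb Z\setminus\{0\}$) and relations: $k_hk_{h'}=k_{h+h'}$, $k_0=1$; all $k_h,h_{i,m}$ commute pairwise; $k_hx_{j,r}^{\pm}k_{-h}=q^{\pm\alpha_j(h)}x_{j,r}^{\pm}$; $h_{i,m}x_{j,r}^{\pm}-x_{j,r}^{\pm}h_{i,m}=\pm\frac1m[mB_{i,j}]_q x_{j,m+r}^{\pm}$; $x_{i,r}^+x_{j,s}^--x_{j,s}^-x_{i,r}^+=\delta_{i,j}\frac{\phi^+_{i,r+s}-\phi^-_{i,r+s}}{q_i-q_i^{-1}}$; $(w-q^{\pm B_{i,j}}z)x_i^{\pm}(z)x_j^{\pm}(w)=(q^{\pm B_{i,j}}w-z)x_j^{\pm}(w)x_i^{\pm}(z)$; and the affine quantum Serre relations: for $i\ne j$, $s=1-C_{i,j}$, $\sum_{\pi\in\Sigma_s}\sum_{k=0}^s(-1)^k\begin{bmatrix}s\\k\end{bmatrix}_{q_i}x_i^{\pm}(w_{\pi(1)})\cdots x_i^{\pm}(w_{\pi(k)})x_j^{\pm}(z)x_i^{\pm}(w_{\pi(k+1)})\cdots x_i^{\pm}(w_{\pi(s)})=0$. Here $x_i^\pm(w)=\sum_r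 x_{i,r}^\pm w^r$ and $\sum_{m\ge0}\phi^{\pm}_{i,\pm m}z^{\pm m}=k_{\pm r_i\alpha_i^\vee}\exp(\pm(q-q^{-1})\sum_{m\ge1}h_{i,\pm m}z^{\pm m})$, $\phi^+_{i,m}=0$ for $m<0$, $\phi^-_{i,m}=0$ for $m>0$. $\mathcal U_q(\mathfrak h)$ is the subalgebra generated by the $k_h$, $\mathcal U_q(\hat{\mathfrak h})$ that generated by the $k_h,h_{i,m}$. $\mathcal U_q'(\hat{\mathfrak g})=\mathcal U_q(\hat{\mathfrak g})\otimes\mathbb C(u)$. **Modules.** For a $\mathcal U_q(\mathfrak h)$-module $V$ and $\omega\in\mathfrak h^*$, $V_\omega=\{v\mid k_h v=q^{\omega(h)}v\ \forall h\in\mathfrak h\}$. $\mathrm{Mod}(\mathcal U_q(\mathfrak h))$ is the category of $\mathcal U_q(\mathfrak h)$-modules $V=\bigoplus_\omega V_\omega$ with all $V_\omega$ finite dimensional, all weights in a finite union $\bigcup_j\mathcal S(\lambda_j)$, and such that for all $\omega,i$ there is $R\ge0$ with $V_{\omega\pm r\alpha_i}=\{0\}$ for $r\ge R$. $\mathrm{Mod}(\mathcal U_q(\hat{\mathfrak g}))$ is the category of $\mathcal U_q(\hat{\mathfrak g})$-modules whose restriction to $\mathcal U_q(\mathfrak h)$ is in $\mathrm{Mod}(\mathcal U_q(\mathfrak h))$. An $(l,u)$-weight is a couple $(\lambda,\Psi(u))$, $\lambda\in\mathfrak h^*$, $\Psi(u)=(\Psi^\pm_{i,\pm m}(u))_{i\in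 I,m\ge0}$, $\Psi^\pm_{i,\pm m}(u)\in\mathbb C[u^{\pm1}]$, $\Psi^\pm_{i,0}(u)=q_i^{\pm\lambda(\alpha_i^\vee)}$. $\mathrm{Mod}(\mathcal U'_q(\hat{\mathfrak g}))$ is the category of $\mathcal U_q'(\hat{\mathfrak g})$-modules $V$ for which there is a $\mathbb C$-subspace $W\subset V$ such that: (i) $V\simeq W\otimes_{\mathbb C}\mathbb C(u)$; (ii) $W$ is stable under $\mathcal U_q(\mathfrak h)$ and is an object of $\mathrm{Mod}(\mathcal U_q(\mathfrak h))$; (iii) the image of $W\otimes\mathbb C[u^{\pm}]$ in $V$ is stable under $\mathcal U_q(\hat{\mathfrak h})$; (iv) for all $\omega\in\mathfrak h^*$, $i\in I$, $r\in\mathbb Z$ there are finitely many $\mathbb C$-linear operators $f^\pm_{k,k',\lambda}:W_\omega\to V$ ($k,k'\ge0$, $\lambda\in\mathbb C^*$) such that for all $m\ge0$, $v\in W_\omega$: $x^\pm_{i,r\pm m}(v)=\sum_{k,k',\lambda}\lambda^mu^{km}m^{k'}f^\pm_{k,k',\lambda}(v)$; (v) $V=\bigoplus_{(\lambda,\Psi(u))}V_{(\lambda,\Psi(u))}$ over $(l,u)$-weights, where $V_{(\lambda,\Psi(u))}=\{v\in V_\lambda\mid\exists p\ge0,\forall i\in I,m\ge0,\ (\phi^\pm_{i,\pm m}-\Psi^\pm_{i,\pm m}(u))^pv=0\}$. **$\mathcal A$-forms.** $\mathcal A=\{f(u)/g(u)\mid f,g\in\mathbb C[u^{\pm}],\ g(1)\ne0\}\subset\mathbb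 C(u)$ and $\mathcal U_q^u(\hat{\mathfrak g})=\mathcal U_q(\hat{\mathfrak g})\otimes_{\mathbb C}\mathcal A\subset\mathcal U'_q(\hat{\mathfrak g})$. An $\mathcal A$-form of a module $M$ (an object of $\mathrm{Mod}(\mathcal U'_q(\hat{\mathfrak g}))$ or a $\mathcal U'_q(\hat{\mathfrak g})$-submodule of one) is an $\mathcal A$-submodule $\tilde M\subset M$ such that: $\tilde M$ is stable under $\mathcal U^u_q(\hat{\mathfrak g})$; $\tilde M$ generates the $\mathbb C(u)$-vector space $M$; for every $\lambda\in\mathfrak h^*$, $\tilde M\cap M_\lambda$ is a finitely generated $\mathcal A$-module. Its specialization is the $\mathcal U_q(\hat{\mathfrak g})$-module $(\tilde M)_{u=1}=\tilde M/((u-1)\tilde M)$. *)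

(* Defs.v *)
From HB Require Import structures.
From mathcomp Require Import all_boot all_order all_algebra perm.
From mathcomp Require finmap.
From mathcomp Require Import boolp classical_sets.
From mathcomp.multinomials Require Import monalg.

Set Implicit Arguments.
Unset Strict Implicit.
Unset Printing Implicit Defensive.

Import GRing.Theory Num.Theory.

Local Open Scope quotient_scope.
Local Open Scope classical_set_scope.
Local Open Scope ring_scope.

Section FreeAlgebra.
Variables (K : fieldType) (G : choiceType).

Definition free_alg := {malg K[{fmonom G}]}.

HB.instance Definition _ := GRing.Lalgebra.on free_alg.

Lemma free_alg_scalerAr (c : K) (x y : {malg K[{fmonom G}]}) :
  c *: (x * y) = x * (c *: y).
Proof.
apply/malgP => m; rewrite (mcoeffZ c (x * y)) (mcoeffMl x y).
rewrite (mcoeffMlw _ (finmap.fsubset_refl _) (msuppZ_le c y)) mulr_sumr.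
apply: eq_bigr => a _; rewrite mulr_sumr; apply: eq_bigr => b _.
by rewrite mcoeffZ mulrnAr mulrCA.
Qed.

HB.instance Definition _ :=
  GRing.Lalgebra_isAlgebra.Build K free_alg free_alg_scalerAr.

Definition free_gen (g : G) : free_alg := << fmu g >>.

End FreeAlgebra.

Section QuotientAlgebra.
Variables (K : fieldType) (A : algType K) (S : set A).

Definition two_sided_ideal (J : set A) : Prop :=
  [/\ J 0, forall x y, J x -> J y -> J (x - y),
      forall a x, J x -> J (a * x) & forall a x, J x -> J (x * a)].

Definition ideal_gen : set A := smallest two_sided_ideal S.

Lemma ideal_genP : two_sided_ideal ideal_gen.
Proof.
split=> [|x y Jx Jy|a x Jx|a x Jx] J JS; have [[J0 JB Jl Jr] _] := JS => //.
- by apply: JB; [exact: Jx|exact: Jy].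
- by apply: Jl; exact: Jx.
- by apply: Jr; exact: Jx.
Qed.

Definition ideal_pred : {pred A} := fun x => `[< ideal_gen x >].

Lemma ideal_pred_zmod : zmod_closed ideal_pred.
Proof.
case: ideal_genP => J0 JB _ _; split; first exact/asboolP.
by move=> x y /asboolP Jx /asboolP Jy; apply/asboolP; exact: JB.
Qed.

HB.instance Definition _ := GRing.isZmodClosed.Build A ideal_pred ideal_pred_zmod.

(* Library algebras are nonzero, hence the properness argument. *)
Definition quot_alg of ~ ideal_gen 1 := Quotient.quot ideal_pred.

Section Structure.
Variable proper : ~ ideal_gen 1.
Local Notation Q := (quot_alg proper).

HB.instance Definition _ := GRing.Zmodule.on Q.

Definition quot_pi (x : A) : Q := \pi_(Quotient.quot ideal_pred) x.

Lemma quot_pi_eq (x y : A) : quot_pi x = quot_pi y <-> ideal_gen (x - y).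
Proof.
split=> [/eqP|J]; first by rewrite -Quotient.idealrBE => /asboolP.
by apply/eqP; rewrite -Quotient.idealrBE; apply/asboolP.
Qed.

Lemma quot_repK (x : Q) : quot_pi (repr x) = x.
Proof. exact: reprK. Qed.

Lemma quot_piD x y : quot_pi (x + y) = quot_pi x + quot_pi y.
Proof. exact: (raddfD \pi_(Quotient.quot ideal_pred)). Qed.

Definition quot_one : Q := quot_pi 1.
Definition quot_mul (x y : Q) : Q := quot_pi (repr x * repr y).
Definition quot_scale (c : K) (x : Q) : Q := quot_pi (c *: repr x).

Lemma ideal_repr (x : A) : ideal_gen (repr (quot_pi x) - x).
Proof. by apply/quot_pi_eq; exact: quot_repK. Qed.

Lemma quot_piM x y : quot_pi (x * y) = quot_mul (quot_pi x) (quot_pi y).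
Proof.
apply/esym/quot_pi_eq; set x' := repr _; set y' := repr _.
have -> : x' * y' - x * y = (x' - x) * y' - (x * y - x * y').
  by rewrite mulrBl opprB addrA subrK.
have [J0 JB Jl Jr] := ideal_genP; rewrite -mulrBr.
have H1 : ideal_gen ((x' - x) * y') by apply: Jr; exact: ideal_repr.
have H2 : ideal_gen (x * (y' - y)) by apply: Jl; exact: ideal_repr.
rewrite -[y - y']opprB mulrN -[- (x * _)]sub0r.
exact: (JB _ _ H1 (JB _ _ J0 H2)).
Qed.

Lemma quot_piZ c x : quot_pi (c *: x) = quot_scale c (quot_pi x).
Proof.
apply/esym/quot_pi_eq; rewrite -scalerBr -mulr_algl.
by have [_ _ Jl _] := ideal_genP; by apply: Jl; exact: ideal_repr.
Qed.

Lemma quot_ind (P : Q -> Prop) : (forall x, P (quot_pi x)) -> forall x, P x.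
Proof. by move=> H x; rewrite -[x]quot_repK. Qed.

Lemma quot_mulA : associative quot_mul.
Proof.
by elim/quot_ind=> x; elim/quot_ind=> y; elim/quot_ind=> z; rewrite -!quot_piM mulrA.
Qed.
Lemma quot_mul1 : left_id quot_one quot_mul.
Proof. by elim/quot_ind=> x; rewrite -quot_piM mul1r. Qed.
Lemma quot_mulr1 : right_id quot_one quot_mul.
Proof. by elim/quot_ind=> x; rewrite -quot_piM mulr1. Qed.
Lemma quot_mulDl : left_distributive quot_mul +%R.
Proof.
elim/quot_ind=> x; elim/quot_ind=> y; elim/quot_ind=> z.
by rewrite -quot_piD -!quot_piM mulrDl quot_piD.
Qed.
Lemma quot_mulDr : right_distributive quot_mul +%R.
Proof.
elim/quot_ind=> x; elim/quot_ind=> y; elim/quot_ind=> z.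
by rewrite -quot_piD -!quot_piM mulrDr quot_piD.
Qed.
Lemma quot_1neq0 : quot_one != 0.
Proof.
apply/eqP; rewrite -(raddf0 \pi_(Quotient.quot ideal_pred)).
by move=> /quot_pi_eq; rewrite subr0.
Qed.

HB.instance Definition _ := GRing.Zmodule_isNzRing.Build Q
  quot_mulA quot_mul1 quot_mulr1 quot_mulDl quot_mulDr quot_1neq0.

Lemma quot_scaleA a b x : quot_scale a (quot_scale b x) = quot_scale (a * b) x.
Proof. by elim/quot_ind: x => x; rewrite -!quot_piZ scalerA. Qed.
Lemma quot_scale1 : left_id 1 quot_scale.
Proof. by elim/quot_ind=> x; rewrite -quot_piZ scale1r. Qed.
Lemma quot_scaleDr : right_distributive quot_scale +%R.
Proof.
move=> a; elim/quot_ind=> x; elim/quot_ind=> y.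
by rewrite -quot_piD -!quot_piZ scalerDr quot_piD.
Qed.
Lemma quot_scaleDl x : {morph quot_scale^~ x : a b / a + b}.
Proof. by elim/quot_ind: x => x a b; rewrite -!quot_piZ scalerDl quot_piD. Qed.

HB.instance Definition _ := GRing.Zmodule_isLmodule.Build K Q
  quot_scaleA quot_scale1 quot_scaleDr quot_scaleDl.

Lemma quot_pi_mul x y : quot_pi (x * y) = quot_pi x * quot_pi y.
Proof. exact: quot_piM. Qed.

Lemma quot_pi_scale c x : quot_pi (c *: x) = c *: quot_pi x.
Proof. exact: quot_piZ. Qed.

Lemma quot_scaleAl (a : K) (x y : Q) : a *: (x * y) = (a *: x) * y.
Proof.
elim/quot_ind: x => x; elim/quot_ind: y => y.
by rewrite -quot_pi_mul -[LHS]quot_pi_scale -(quot_pi_scale a x) -quot_pi_mul scalerAl.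
Qed.
HB.instance Definition _ := GRing.Lmodule_isLalgebra.Build K Q quot_scaleAl.

Lemma quot_scaleAr (a : K) (x y : Q) : a *: (x * y) = x * (a *: y).
Proof.
elim/quot_ind: x => x; elim/quot_ind: y => y.
by rewrite -quot_pi_mul -[LHS]quot_pi_scale -(quot_pi_scale a y) -quot_pi_mul scalerAr.
Qed.
HB.instance Definition _ := GRing.Lalgebra_isAlgebra.Build K Q quot_scaleAr.

End Structure.
End QuotientAlgebra.

Record cartan_datum (n : nat) := CartanDatum {
  cartan : 'M[int]_n;
  cartan_diag : forall i, cartan i i = 2;
  cartan_offdiag : forall i j, i != j -> cartan i j <= 0;
  cartan_eq0 : forall i j, cartan i j = 0 <-> cartan j i = 0;
  symmetrizer : 'I_n -> nat;
  symmetrizer_gt0 : forall i, (0 < symmetrizer i)%N;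
  symmetrizerP : forall i j,
    (symmetrizer i)%:Z * cartan i j = (symmetrizer j)%:Z * cartan j i;
  cartan_h : vectType rat;
  dim_cartan_h :
    \dim {: cartan_h} = (2 * n - \rank (map_mx intr cartan : 'M[rat]_n))%N;
  root : 'I_n -> 'Hom(cartan_h, rat^o);
  coroot : 'I_n -> cartan_h;
  root_free : free [seq root i | i : 'I_n];
  coroot_free : free [seq coroot i | i : 'I_n];
  root_coroot : forall i j, root j (coroot i) = (cartan i j)%:~R
}.

(* [qpow s] is q^s for rational s; q itself is [qpow 1]. *)
Record q_param (K : fieldType) := QParam {
  qpow :> rat -> K;
  qpowD : forall s t, qpow (s + t) = qpow s * qpow t;
  q_neq0 : qpow 1 != 0;
  q_not_root1 : forall m : nat, (0 < m)%N -> qpow 1 ^+ m != 1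
}.

(* Throughout, a sign [s : bool] is + when [s = true]. *)
Definition sgn (s : bool) : int := if s then 1 else -1.

Section QNumbers.
Variable K : fieldType.

Definition qint (p : K) (l : int) : K := (p ^ l - p ^ (- l)) / (p - p^-1).
Definition qfact (p : K) (m : nat) : K := \prod_(1 <= l < m.+1) qint p l.
Definition qbinom (p : K) (m k : nat) : K :=
  qfact p m / (qfact p k * qfact p (m - k)).

End QNumbers.

Definition nzint := {m : int | m != 0}.

Lemma signed_succ_neq0 (s : bool) (l : nat) : sgn s * l.+1%:Z != 0.
Proof. by case: s; rewrite ?mul1r ?mulN1r ?oppr_eq0. Qed.

Definition signed_succ (s : bool) (l : nat) : nzint :=
  exist _ (sgn s * l.+1%:Z) (signed_succ_neq0 s l).

Section Relations.
Variables (K : fieldType) (n : nat) (D : cartan_datum n) (q : q_param K).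

Local Notation C := (cartan D).
Local Notation r_ := (symmetrizer D).
Local Notation hh := (cartan_h D).

Definition symm_cartan (i j : 'I_n) : int := (r_ i)%:Z * C i j.
Local Notation B := symm_cartan.

Definition qi (i : 'I_n) : K := q (r_ i)%:R.

(* The images x^s_{i,r}, k_h and h_{i,m} of the generators in an algebra. *)
Variables (A : algType K) (x : bool -> 'I_n -> int -> A) (k : hh -> A)
  (h : 'I_n -> nzint -> A).

(* s(q - q^-1) sum_(1 <= l <= m) h_{i,sl} z^l *)
Definition h_series (s : bool) (i : 'I_n) (m : nat) : {poly A} :=
  \poly_(l < m.+1)
    if l is l'.+1 then ((sgn s)%:~R * (q 1 - (q 1)^-1)) *: h i (signed_succ s l')
    else 0.

(* phi^s_{i,sm}: a series without constant term only contributes its terms of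
   degree at most m, and its powers of exponent at most m, to the z^m
   coefficient of its exponential. *)
Definition phi (s : bool) (i : 'I_n) (m : nat) : A :=
  k (coroot D i *~ (sgn s * (r_ i)%:Z)) *
  \sum_(p < m.+1) (p`!%:R : K)^-1 *: (h_series s i m ^+ p)`_m.

(* phi^s_{i,t}, extended by zero to all t : int. *)
Definition phi_int (s : bool) (i : 'I_n) (t : int) : A :=
  if 0 <= sgn s * t then phi s i `|t|%N else 0.

(* The coefficient of w_1^(a_1) ... w_m^(a_m) z^b in the Serre relation,
   with m = 1 - C_{i,j}. *)
Definition serre (s : bool) (i j : 'I_n) (m : nat) (a : 'I_m -> int) (b : int)
    : A :=
  \sum_(p : 'S_m) \sum_(t < m.+1) ((-1) ^+ t * qbinom (qi i) m t) *:
    ((\prod_(l < m | (l < t)%N) x s i (a (p l))) * x s j b *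
     (\prod_(l < m | (t <= l)%N) x s i (a (p l)))).

(* [rel_drinfeld] and [rel_serre] are the coefficients of the relations between
   generating series: of z^a w^b in the former, see [serre] for the latter. *)
Inductive affine_rel : A -> A -> Prop :=
| rel_kD c c' : affine_rel (k c * k c') (k (c + c'))
| rel_k0 : affine_rel (k 0) 1
| rel_kk c c' : affine_rel (k c * k c') (k c' * k c)
| rel_kh c i m : affine_rel (k c * h i m) (h i m * k c)
| rel_hh i m j m' : affine_rel (h i m * h j m') (h j m' * h i m)
| rel_kx s c j r :
    affine_rel (k c * x s j r * k (- c))
               (q ((sgn s)%:~R * root D j c) *: x s j r)
| rel_hx s i (m : nzint) j r :
    affine_rel (h i m * x s j r - x s j r * h i m)
               (((sgn s)%:~R * (val m)%:~R^-1 * qint (q 1) (val m * B i j)) *: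
                  x s j (val m + r))
| rel_xx i j r t :
    affine_rel (x true i r * x false j t - x false j t * x true i r)
               (if i == j then
                  (qi i - (qi i)^-1)^-1 *:
                    (phi_int true i (r + t) - phi_int false i (r + t))
                else 0)
| rel_drinfeld s i j a b :
    affine_rel
      (x s i a * x s j (b - 1)
         - q 1 ^ (sgn s * B i j) *: (x s i (a - 1) * x s j b))
      (q 1 ^ (sgn s * B i j) *: (x s j (b - 1) * x s i a)
         - x s j b * x s i (a - 1))
| rel_serre s i j a b : i != j ->
    affine_rel (@serre s i j `|1 - C i j|%N a b) 0.

Definition affine_relators : set A :=
  [set z | exists a b, affine_rel a b /\ z = a - b].

(* The relations hold in the trivial representation (x and h act by 0, the k_h
   by 1), hence the algebra that they present is nonzero. *)
Variable eps : A -> K.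
Hypotheses (epsB : {morph eps : a b / a - b}) (epsD : {morph eps : a b / a + b})
  (epsM : {morph eps : a b / a * b}) (eps0 : eps 0 = 0) (eps1 : eps 1 = 1)
  (epsZ : forall c a, eps (c *: a) = c * eps a)
  (epsx : forall s i r, eps (x s i r) = 0) (epsk : forall c, eps (k c) = 1)
  (epsh : forall i m, eps (h i m) = 0).

Let eps_sum (I : Type) (s : seq I) P (f : I -> A) :
  eps (\sum_(i <- s | P i) f i) = \sum_(i <- s | P i) eps (f i).
Proof. exact: (big_morph eps epsD eps0). Qed.

Lemma character_phi s i m : eps (phi s i m) = (m == 0)%:R.
Proof.
rewrite epsM epsk mul1r eps_sum big_ord_recl.
rewrite big1 => [|p _]; last first.
  rewrite epsZ exprS coefM eps_sum big1 ?mulr0// => l _.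
  rewrite epsM coef_poly ltn_ord.
  case: (nat_of_ord l) => [|l']; first by rewrite eps0 mul0r.
  by rewrite epsZ epsh mulr0 mul0r.
rewrite addr0 epsZ expr0 invr1 mul1r coef1.
by case: eqP => _; rewrite ?eps1 ?eps0.
Qed.

Lemma character_phi_int s i t : eps (phi_int s i t) = (t == 0)%:R.
Proof.
rewrite /phi_int; case: ifP => [_|]; first by rewrite character_phi absz_eq0.
by case: (t =P 0) => [->|_]; rewrite ?mulr0 ?lexx // eps0.
Qed.

Lemma character_rel a b : affine_rel a b -> eps a = eps b.
Proof.
case=> {a b}.
- by move=> c c'; rewrite epsM !epsk mul1r.
- by rewrite epsk eps1.
- by move=> c c'; rewrite !epsM mulrC.
- by move=> c i m; rewrite !epsM mulrC.
- by move=> i m j m'; rewrite !epsM mulrC.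
- by move=> s c j r; rewrite epsZ !epsM epsx !(mulr0, mul0r).
- by move=> s i m j r; rewrite epsZ epsB !epsM !epsx !(mulr0, mul0r) subrr.
- move=> i j r t; rewrite epsB !epsM !epsx mul0r subrr.
  by case: ifP => _; rewrite ?eps0// epsZ epsB !character_phi_int subrr mulr0.
- by move=> s i j a b; rewrite !epsB !epsZ !epsM !epsx !(mul0r, mulr0).
- move=> s i j a b _; rewrite eps0 eps_sum big1// => p _.
  by rewrite eps_sum big1// => t _; rewrite epsZ !epsM epsx !(mulr0, mul0r).
Qed.

End Relations.

Section Affinization.
Variables (K : fieldType) (n : nat) (D : cartan_datum n) (q : q_param K).

Definition gen := ((bool * 'I_n * int) + cartan_h D + ('I_n * nzint))%type.

Definition fx (s : bool) (i : 'I_n) (r : int) : free_alg K gen :=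
  free_gen K (inl (inl (s, i, r)) : gen).
Definition fk (c : cartan_h D) : free_alg K gen := free_gen K (inl (inr c) : gen).
Definition fh (i : 'I_n) (m : nzint) : free_alg K gen := free_gen K (inr (i, m) : gen).

Definition Uq_relators : set (free_alg K gen) := affine_relators q fx fk fh.

Definition gen_counit (g : gen) : K := if g is inl (inr _) then 1 else 0.

Definition word_counit (w : {fmonom gen}) : K :=
  \prod_(g <- (w : seq gen)) gen_counit g.

Lemma word_counit_mmorphism : mmorphism word_counit.
Proof.
split=> [w w'|]; rewrite /word_counit; first by rewrite fmM big_cat.
by rewrite fm1 big_nil.
Qed.
HB.instance Definition _ :=
  isMultiplicative.Build {fmonom gen} K word_counit word_counit_mmorphism.

Definition counit (a : free_alg K gen) : K := mmap idfun word_counit a.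

Lemma counit_gen g : counit (free_gen K g) = gen_counit g.
Proof. by rewrite /counit mmapU mul1r /word_counit fmuE big_seq1. Qed.

Lemma counitB : {morph counit : a b / a - b}. Proof. exact: rmorphB. Qed.
Lemma counitD : {morph counit : a b / a + b}. Proof. exact: rmorphD. Qed.
Lemma counitM : {morph counit : a b / a * b}. Proof. exact: rmorphM. Qed.
Lemma counit0 : counit 0 = 0. Proof. exact: rmorph0. Qed.
Lemma counit1 : counit 1 = 1. Proof. exact: rmorph1. Qed.
Lemma counitZ c a : counit (c *: a) = c * counit a. Proof. exact: mmapZ. Qed.

Lemma counit_rel a b : affine_rel q fx fk fh a b -> counit a = counit b.
Proof.
apply: character_rel; [exact: counitB|exact: counitD|exact: counitM|exact: counit0
  |exact: counit1|exact: counitZ| | |] => *; exact: counit_gen.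
Qed.

Lemma Uq_proper : ~ ideal_gen Uq_relators 1.
Proof.
move=> U1; suff : counit 1 = 0 by move=> /eqP; rewrite counit1 oner_eq0.
apply: (U1 [set a | counit a = 0]); split; last first.
  by move=> _ [a [b [ab ->]]] /=; rewrite counitB (counit_rel ab) subrr.
split=> /=; first exact: counit0.
- by move=> a b a0 b0; rewrite counitB a0 b0 subrr.
- by move=> a b b0; rewrite counitM b0 mulr0.
- by move=> a b b0; rewrite counitM b0 mul0r.
Qed.

(* U_q(\hat g) *)
Definition Uq := quot_alg Uq_proper.

HB.instance Definition _ := GRing.Algebra.on Uq.

Definition Ux s i r : Uq := quot_pi Uq_proper (fx s i r).
Definition Uk c : Uq := quot_pi Uq_proper (fk c).
Definition Uh i m : Uq := quot_pi Uq_proper (fh i m).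
Definition Uphi s i m : Uq := phi q Uk Uh s i m.

Definition subalgebra (A : algType K) (S : set A) : Prop :=
  [/\ S 1, forall c a b, S a -> S b -> S (c *: a + b) &
      forall a b, S a -> S b -> S (a * b)].

(* U_q(h) and U_q(\hat h) *)
Definition Uq_h : set Uq := smallest (@subalgebra Uq) (range Uk).
Definition Uq_hhat : set Uq :=
  smallest (@subalgebra Uq) (range Uk `|` [set Uh i m | i in setT & m in setT]).

End Affinization.

Section RationalFunctions.
Variable K : fieldType.

Local Notation ratfun := {fraction {poly K}}.
Local Notation "p %:F" := (@tofrac {poly K} p).

Definition ratfun_const : K -> ratfun := @tofrac {poly K} \o polyC.
HB.instance Definition _ := GRing.RMorphism.on ratfun_const.

Definition uvar : ratfun := 'X%:F.

Definition laurent : set ratfun :=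
  [set f | exists (p : {poly K}) (k : nat), f = p%:F / uvar ^+ k].

Definition laurent_at1 (f : ratfun) (c : K) : Prop :=
  exists (p : {poly K}) (k : nat), f = p%:F / uvar ^+ k /\ p.[1] = c.

Definition localA : set ratfun :=
  [set a | exists f g c, [/\ laurent f, laurent_at1 g c, c != 0 & a = f / g]].

Lemma localA_const c : localA (ratfun_const c).
Proof.
exists (ratfun_const c), 1, 1; split; rewrite ?oner_eq0 ?divr1//.
  by exists c%:P, 0; rewrite expr0 divr1.
by exists 1, 0; rewrite expr0 divr1 hornerC rmorph1.
Qed.

Lemma localA1 : localA 1.
Proof. by rewrite -(rmorph1 ratfun_const); exact: localA_const. Qed.

Lemma laurent_mul f g : laurent f -> laurent g -> laurent (f * g).
Proof.
move=> [p [k ->]] [p' [k' ->]]; exists (p * p'), (k + k')%N.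
by rewrite rmorphM exprD invfM mulrACA.
Qed.

Lemma localA_mul a b : localA a -> localA b -> localA (a * b).
Proof.
move=> [f [g [c [fL [p [k [-> pc]]] c0 ->]]]] [f' [g' [c' [fL' [p' [k' [-> pc']]] c0' ->]]]].
exists (f * f'), (p%:F / uvar ^+ k * (p'%:F / uvar ^+ k')), (c * c').
split; [exact: laurent_mul| |by rewrite mulf_neq0|by rewrite mulf_div].
exists (p * p'), (k + k')%N; rewrite hornerM pc pc'; split=> //.
by rewrite rmorphM exprD invfM mulrACA.
Qed.

End RationalFunctions.

Section Subsets.
Variables (L : fieldType) (V : lmodType L).

(* In this section, P is a subring of L, seen as a set of scalars. *)
Definition submod (P : set L) (S : set V) : Prop :=
  [/\ S 0, forall x y, S x -> S y -> S (x + y) &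
      forall a x, P a -> S x -> S (a *: x)].

Definition span_over (P : set L) (S : set V) : set V :=
  [set v | exists t : seq (L * V),
     (forall p, p \in t -> P p.1 /\ S p.2) /\ v = \sum_(p <- t) p.1 *: p.2].

Definition fin_gen (P : set L) (S : set V) : Prop :=
  exists2 t : seq V, [set` t] `<=` S & S `<=` span_over P [set` t].

(* W is the direct sum of the E i, where i ranges over I. *)
Definition direct_sum (T : Type) (I : set T) (E : T -> set V) (W : set V) : Prop :=
  [/\ forall i, I i -> E i `<=` W,
      forall w, W w -> exists (m : nat) (i : 'I_m -> T) (x : 'I_m -> V),
        (forall j, I (i j) /\ E (i j) (x j)) /\ w = \sum_j x j &
      forall (m : nat) (i : 'I_m -> T) (x : 'I_m -> V), injective i ->
        (forall j, I (i j) /\ E (i j) (x j)) -> \sum_j x j = 0 ->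
        forall j, x j = 0].

(* For P a subfield of L and W a P-subspace of V, the natural map
   W (x)_P L -> V is bijective: it is onto when W spans V over L, and injective
   when families of W that are free over P are free over L. *)
Definition scalar_extension_of (P : set L) (W : set V) : Prop :=
  span_over setT W = setT /\
  forall (m : nat) (w : 'I_m -> V), (forall j, W (w j)) ->
    (forall c : 'I_m -> L, (forall j, P (c j)) ->
       \sum_j c j *: w j = 0 -> forall j, c j = 0) ->
    forall c : 'I_m -> L, \sum_j c j *: w j = 0 -> forall j, c j = 0.

End Subsets.

(* A module over A (x)_K L, for L an extension of K: an L-vector space with
   an action of A by L-linear operators. For L = K, an A-module. *)
Record rep (K : fieldType) (A : algType K) (L : fieldType)
    (iota : {rmorphism K -> L}) (V : lmodType L) := Rep {
  act :> A -> V -> V;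
  actD : forall a v w, act a (v + w) = act a v + act a w;
  actZ : forall a c v, act a (c *: v) = c *: act a v;
  act_addl : forall a b v, act (a + b) v = act a v + act b v;
  act_scalel : forall c a v, act (c *: a) v = iota c *: act a v;
  act1 : forall v, act 1 v = v;
  actM : forall a b v, act (a * b) v = act a (act b v)
}.

(* The action of the element sum_p p.2 (x) p.1 of A (x)_K L. *)
Definition tensor_act (K : fieldType) (A : algType K) (L : fieldType)
    (iota : {rmorphism K -> L}) (V : lmodType L) (M : rep A iota V)
    (t : seq (L * A)) (v : V) : V :=
  \sum_(p <- t) p.1 *: M p.2 v.

Definition tensor_orbit (K : fieldType) (A : algType K) (L : fieldType)
    (iota : {rmorphism K -> L}) (V : lmodType L) (M : rep A iota V)
    (P : set L) (v : V) : set V :=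
  [set tensor_act M t v | t in [set t : seq (L * A) | forall p, p \in t -> P p.1]].

(* A subspace over the subfield K of an L-vector space, as a K-vector space. *)
Section SubModule.
Variables (K L : fieldType) (iota : {rmorphism K -> L}) (V : lmodType L).
Variables (N : set V) (hN : submod (range iota) N).

Definition sub_pred of submod (range iota) N : {pred V} := fun x => `[< N x >].

Lemma sub_pred_zmod : zmod_closed (sub_pred hN).
Proof.
case: (hN) => N0 ND NZ; split; first exact/asboolP.
move=> x y /asboolP Nx /asboolP Ny; apply/asboolP/ND => //.
by rewrite -scaleN1r -(rmorphN1 iota); apply: NZ => //; exists (- 1).
Qed.

HB.instance Definition _ := GRing.isZmodClosed.Build V (sub_pred hN) sub_pred_zmod.

Definition sub_mod := {x : V | x \in sub_pred hN}.

HB.instance Definition _ := SubChoice.on sub_mod.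
HB.instance Definition _ := [SubChoice_isSubZmodule of sub_mod by <:].

Lemma sub_modP (x : sub_mod) : N (val x).
Proof. exact/asboolP/(valP x). Qed.

Definition sub_mk (x : V) (Nx : N x) : sub_mod := exist _ x (asboolT Nx).

Lemma sub_mod_scale_subproof (c : K) (x : sub_mod) : N (iota c *: val x).
Proof. by have [_ _] := hN; apply; [exists c|exact: sub_modP]. Qed.

Definition sub_scale (c : K) (x : sub_mod) : sub_mod :=
  sub_mk (sub_mod_scale_subproof c x).

Lemma sub_scaleA a b x : sub_scale a (sub_scale b x) = sub_scale (a * b) x.
Proof. by apply: val_inj; rewrite /= scalerA rmorphM. Qed.
Lemma sub_scale1 : left_id 1 sub_scale.
Proof. by move=> x; apply: val_inj; rewrite /= rmorph1 scale1r. Qed.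
Lemma sub_scaleDr : right_distributive sub_scale +%R.
Proof. by move=> a x y; apply: val_inj; rewrite /= scalerDr. Qed.
Lemma sub_scaleDl x : {morph sub_scale^~ x : a b / a + b}.
Proof. by move=> a b; apply: val_inj; rewrite /= rmorphD scalerDl. Qed.

HB.instance Definition _ := GRing.Zmodule_isLmodule.Build K sub_mod
  sub_scaleA sub_scale1 sub_scaleDr sub_scaleDl.

Variables (A : algType K) (M : rep A iota V).
Hypothesis stabN : forall a x, N x -> N (M a x).

Definition sub_act (a : A) (x : sub_mod) : sub_mod :=
  sub_mk (stabN a (sub_modP x)).

Lemma sub_actD a v w : sub_act a (v + w) = sub_act a v + sub_act a w.
Proof. by apply: val_inj; rewrite /= actD. Qed.
Lemma sub_actZ a c v : sub_act a (c *: v) = c *: sub_act a v.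
Proof. by apply: val_inj; rewrite /= actZ. Qed.
Lemma sub_addA a b v : sub_act (a + b) v = sub_act a v + sub_act b v.
Proof. by apply: val_inj; rewrite /= act_addl. Qed.
Lemma sub_scale_act c a v : sub_act (c *: a) v = c *: sub_act a v.
Proof. by apply: val_inj; rewrite /= act_scalel. Qed.
Lemma sub_act1 v : sub_act 1 v = v.
Proof. by apply: val_inj; rewrite /= act1. Qed.
Lemma sub_actM a b v : sub_act (a * b) v = sub_act a (sub_act b v).
Proof. by apply: val_inj; rewrite /= actM. Qed.

Definition sub_rep : rep A (idfun : {rmorphism K -> K}) sub_mod :=
  Rep (iota := idfun) sub_actD sub_actZ sub_addA sub_scale_act sub_act1 sub_actM.

End SubModule.

Section QuotientModule.
Variables (K : fieldType) (V : lmodType K).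
Variables (N : set V) (hN : submod setT N).

Definition quo_pred of submod setT N : {pred V} := fun x => `[< N x >].

Lemma quo_pred_zmod : zmod_closed (quo_pred hN).
Proof.
case: (hN) => N0 ND NZ; split; first exact/asboolP.
move=> x y /asboolP Nx /asboolP Ny; apply/asboolP/ND => //.
by rewrite -scaleN1r; apply: NZ.
Qed.

HB.instance Definition _ := GRing.isZmodClosed.Build V (quo_pred hN) quo_pred_zmod.

Definition quo_mod := Quotient.quot (quo_pred hN).

HB.instance Definition _ := GRing.Zmodule.on quo_mod.

Definition quo_pi (x : V) : quo_mod := \pi_(Quotient.quot (quo_pred hN)) x.

Lemma quo_pi_eq (x y : V) : quo_pi x = quo_pi y <-> N (x - y).
Proof.
split=> [/eqP|J]; first by rewrite -Quotient.idealrBE => /asboolP.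
by apply/eqP; rewrite -Quotient.idealrBE; apply/asboolP.
Qed.

Lemma quo_repK (x : quo_mod) : quo_pi (repr x) = x.
Proof. exact: reprK. Qed.

Lemma quo_ind (P : quo_mod -> Prop) :
  (forall x, P (quo_pi x)) -> forall x, P x.
Proof. by move=> H x; rewrite -[x]quo_repK. Qed.

Lemma quo_piD x y : quo_pi (x + y) = quo_pi x + quo_pi y.
Proof. exact: (raddfD \pi_(Quotient.quot (quo_pred hN))). Qed.

(* An additive operator preserving N, on the quotient. *)
Definition quo_lift (f : V -> V) (x : quo_mod) : quo_mod := quo_pi (f (repr x)).

Lemma quo_liftE (f : V -> V) : (forall x y, f (x - y) = f x - f y) ->
  (forall x, N x -> N (f x)) -> forall x, quo_lift f (quo_pi x) = quo_pi (f x).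
Proof.
move=> fB fN x; apply/quo_pi_eq; rewrite -fB; apply: fN.
by apply/quo_pi_eq; exact: quo_repK.
Qed.

Definition quo_scale (c : K) : quo_mod -> quo_mod := quo_lift ( *:%R c).

Lemma quo_scaleE c x : quo_scale c (quo_pi x) = quo_pi (c *: x).
Proof.
apply: quo_liftE => [a b|a Na]; first exact: scalerBr.
by have [_ _] := hN; apply.
Qed.

Lemma quo_scaleA a b x : quo_scale a (quo_scale b x) = quo_scale (a * b) x.
Proof. by elim/quo_ind: x => x; rewrite !quo_scaleE scalerA. Qed.
Lemma quo_scale1 : left_id 1 quo_scale.
Proof. by elim/quo_ind=> x; rewrite quo_scaleE scale1r. Qed.
Lemma quo_scaleDr : right_distributive quo_scale +%R.
Proof.
move=> a; elim/quo_ind=> x; elim/quo_ind=> y.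
by rewrite -quo_piD !quo_scaleE scalerDr quo_piD.
Qed.
Lemma quo_scaleDl x : {morph quo_scale^~ x : a b / a + b}.
Proof. by elim/quo_ind: x => x a b; rewrite !quo_scaleE scalerDl quo_piD. Qed.

HB.instance Definition _ := GRing.Zmodule_isLmodule.Build K quo_mod
  quo_scaleA quo_scale1 quo_scaleDr quo_scaleDl.

Variables (A : algType K) (M : rep A (idfun : {rmorphism K -> K}) V).
Hypothesis stabN : forall a x, N x -> N (M a x).

Definition quo_act (a : A) : quo_mod -> quo_mod := quo_lift (M a).

Lemma quo_actE a x : quo_act a (quo_pi x) = quo_pi (M a x).
Proof.
apply: quo_liftE => [v w|]; last exact: stabN.
by rewrite actD -scaleN1r actZ scaleN1r.
Qed.

Lemma quo_actD a v w : quo_act a (v + w) = quo_act a v + quo_act a w.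
Proof.
elim/quo_ind: v => v; elim/quo_ind: w => w.
by rewrite -quo_piD !quo_actE actD quo_piD.
Qed.
Lemma quo_actZ a c v : quo_act a (c *: v) = c *: quo_act a v.
Proof.
elim/quo_ind: v => v; rewrite [c *: _]quo_scaleE !quo_actE [RHS]quo_scaleE.
by rewrite actZ.
Qed.
Lemma quo_addA a b v : quo_act (a + b) v = quo_act a v + quo_act b v.
Proof. by elim/quo_ind: v => v; rewrite !quo_actE act_addl quo_piD. Qed.
Lemma quo_scale_act c a v : quo_act (c *: a) v = c *: quo_act a v.
Proof.
by elim/quo_ind: v => v; rewrite !quo_actE [RHS]quo_scaleE act_scalel.
Qed.
Lemma quo_act1 v : quo_act 1 v = v.
Proof. by elim/quo_ind: v => v; rewrite quo_actE act1. Qed.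
Lemma quo_actM a b v : quo_act (a * b) v = quo_act a (quo_act b v).
Proof. by elim/quo_ind: v => v; rewrite !quo_actE actM. Qed.

Definition quo_rep : rep A (idfun : {rmorphism K -> K}) quo_mod :=
  Rep (iota := idfun) quo_actD quo_actZ quo_addA quo_scale_act quo_act1 quo_actM.

End QuotientModule.

Section Weights.
Variables (K : fieldType) (n : nat) (D : cartan_datum n) (q : q_param K).
Variables (L : fieldType) (iota : {rmorphism K -> L}) (V : lmodType L).
Variable M : rep (Uq D q) iota V.

Local Notation weight := 'Hom(cartan_h D, rat^o).

Definition weight_space (w : weight) : set V :=
  [set v | forall c, M (Uk q c) v = iota (q (w c)) *: v].

Definition weight_cone (lam : weight) : set weight :=
  [set w | exists b : 'I_n -> nat, w = lam - \sum_i root D i *+ b i].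

(* The K-subspace W of V is stable under U_q(h), and an object of Mod(U_q(h))
   for the induced action. *)
Record in_Mod_Uq_h (W : set V) : Prop := InModUqh {
  modh_sub : submod (range iota) W;
  modh_stable : forall a v, Uq_h a -> W v -> W (M a v);
  modh_sum : direct_sum setT (fun w => W `&` weight_space w) W;
  modh_fin : forall w, fin_gen (range iota) (W `&` weight_space w);
  modh_cone : exists (m : nat) (lam : 'I_m -> weight), forall w,
    (exists2 v, (W `&` weight_space w) v & v != 0) -> exists j, weight_cone (lam j) w;
  modh_nil : forall w i, exists R : nat, forall r, (R <= r)%N ->
    W `&` weight_space (w + root D i *+ r) = [set 0] /\
    W `&` weight_space (w - root D i *+ r) = [set 0]
}.

End Weights.

Definition in_Mod_Uq (K : fieldType) (n : nat) (D : cartan_datum n)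
    (q : q_param K) (V : lmodType K)
    (M : rep (Uq D q) (idfun : {rmorphism K -> K}) V) : Prop :=
  in_Mod_Uq_h M setT.

Section ModUqPrime.
Variables (K : fieldType) (n : nat) (D : cartan_datum n) (q : q_param K).
Local Notation ratfun := {fraction {poly K}}.
Local Notation iota := (@ratfun_const K).
Variables (V : lmodType ratfun) (M : rep (Uq D q) iota V).

Local Notation weight := 'Hom(cartan_h D, rat^o).

(* Candidates (lambda, Psi) for (l,u)-weights, [Psi s i m] being the component
   Psi^s_{i,sm}. *)
Definition lu_pair := (weight * (bool -> 'I_n -> nat -> ratfun))%type.

Definition lu_weight : set lu_pair :=
  [set p : lu_pair | (forall s i m, laurent (p.2 s i m)) /\
           forall s i, p.2 s i 0%N =
             iota (q ((sgn s)%:~R * (symmetrizer D i)%:R * p.1 (coroot D i)))].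

Definition lu_weight_space (p : lu_pair) : set V :=
  weight_space M p.1 `&`
  [set v | exists e : nat, forall s i m,
     iter e (fun w => M (Uphi D q s i m) w - p.2 s i m *: w) v = 0].

(* Condition on x^s_{i,r+sm}, m >= 0, with the upper (resp. lower) signs taken
   together; T is the finite set of triples (k, k', lambda). *)
Definition quasi_polynomial_action (W : set V) (s : bool) (w : weight)
    (i : 'I_n) (r : int) : Prop :=
  exists (T : seq (nat * nat * K)) (f : nat -> nat -> K -> V -> V),
    [/\ uniq T,
        forall k k' lam, (k, k', lam) \in T -> lam != 0 /\
          forall c x y, (W `&` weight_space M w) x ->
            (W `&` weight_space M w) y ->
            f k k' lam (iota c *: x + y) = iota c *: f k k' lam x + f k k' lam y &
        forall (m : nat) v, (W `&` weight_space M w) v ->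
          M (Ux D q s i (r + sgn s * m%:Z)) v =
          \sum_(t <- T) (iota t.2 ^+ m * uvar K ^+ (t.1.1 * m) * (m ^ t.1.2)%:R)
                          *: f t.1.1 t.1.2 t.2 v].

Record Mod_Uq'_form (W : set V) : Prop := ModUqPrimeForm {
  form_ext : scalar_extension_of (range iota) W;
  form_modh : in_Mod_Uq_h M W;
  form_hhat : forall a v, Uq_hhat a -> span_over (@laurent K) W v ->
    span_over (@laurent K) W (M a v);
  form_x : forall s w i r, quasi_polynomial_action W s w i r;
  form_lu : direct_sum lu_weight lu_weight_space setT
}.

Definition in_Mod_Uq' : Prop := exists W : set V, Mod_Uq'_form W.

(* Mt is an A-form of the U'_q(\hat g)-submodule N of V. *)
Record A_form (N Mt : set V) : Prop := AForm {
  A_form_sub : Mt `<=` N;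
  A_form_submod : submod (@localA K) Mt;
  A_form_stable : forall t v, (forall p, p \in t -> localA p.1) -> Mt v ->
    Mt (tensor_act M t v);
  A_form_gen : span_over setT Mt = N;
  A_form_fin : forall w, fin_gen (@localA K) (Mt `&` (N `&` weight_space M w))
}.

Section Specialization.
Variables (Mt : set V) (Mt_sub : submod (@localA K) Mt).
Hypothesis Mt_stable : forall a v, Mt v -> Mt (M a v).

Lemma localA_submod_const : submod (range iota) Mt.
Proof.
case: Mt_sub => M0 MD MZ; split=> // _ x [c _ <-] Mx.
by apply: MZ => //; exact: localA_const.
Qed.

Definition lattice_mod := sub_mod localA_submod_const.
Definition lattice_rep : rep (Uq D q) (idfun : {rmorphism K -> K}) lattice_mod :=
  sub_rep localA_submod_const Mt_stable.

Definition lattice_u1 : set lattice_mod :=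
  [set x | exists y : lattice_mod, val x = (uvar K - 1) *: val y].

Lemma lattice_u1_sub : submod setT lattice_u1.
Proof.
split=> [|x y [x' ex] [y' ey]|c x _ [x' ex]].
- by exists 0; rewrite /= scaler0.
- by exists (x' + y'); rewrite /= ex ey scalerDr.
- by exists (c *: x'); rewrite /= ex !scalerA mulrC.
Qed.

Lemma lattice_u1_stable a x : lattice_u1 x -> lattice_u1 (lattice_rep a x).
Proof. by move=> [y ey]; exists (lattice_rep a y); rewrite /= ey actZ. Qed.

Definition spec_mod : lmodType K := quo_mod lattice_u1_sub.
Definition spec_rep : rep (Uq D q) (idfun : {rmorphism K -> K}) spec_mod :=
  quo_rep lattice_u1_sub lattice_u1_stable.

Definition spec_class (v : V) (Mv : Mt v) : spec_mod :=
  quo_pi lattice_u1_sub (sub_mk localA_submod_const Mv).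

End Specialization.

(* U'_q(\hat g).v and U_q^u(\hat g).v *)
Definition Uq'_orbit (v : V) : set V := tensor_orbit M setT v.
Definition Uqu_orbit (v : V) : set V := tensor_orbit M (@localA K) v.

Lemma Uqu_orbit_submod v : submod (@localA K) (Uqu_orbit v).
Proof.
split=> [|_ _ [t At <-] [t' At' <-]|a _ Aa [t At <-]].
- by exists [::] => //; rewrite /tensor_act big_nil.
- exists (t ++ t'); last by rewrite /tensor_act big_cat.
  by move=> p; rewrite mem_cat => /orP[/At|/At'].
- exists [seq (a * p.1, p.2) | p <- t].
    by move=> _ /mapP[p /At Ap ->] /=; exact: localA_mul.
  by rewrite /tensor_act big_map scaler_sumr; apply: eq_bigr => p _; rewrite scalerA.
Qed.

Lemma Uqu_orbit_stable v a w : Uqu_orbit v w -> Uqu_orbit v (M a w).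
Proof.
move=> [t At <-]; exists [seq (p.1, a * p.2) | p <- t].
  by move=> _ /mapP[p /At Ap ->].
rewrite /tensor_act big_map; elim/big_rec2: _ => [|p x y _ ->].
  by rewrite -(scale0r 0) actZ !scale0r.
by rewrite actD actZ actM.
Qed.

Lemma Uqu_orbit_self v : Uqu_orbit v v.
Proof.
exists [:: (1, 1)] => [p|]; first by rewrite inE => /eqP -> /=; exact: localA1.
by rewrite /tensor_act big_seq1 scale1r act1.
Qed.

Definition orbit_spec_mod (v : V) : lmodType K :=
  spec_mod (Uqu_orbit_submod v).
Definition orbit_spec (v : V) :
    rep (Uq D q) (idfun : {rmorphism K -> K}) (orbit_spec_mod v) :=
  spec_rep (Uqu_orbit_submod v) (@Uqu_orbit_stable v).
Definition orbit_spec_gen (v : V) : orbit_spec_mod v :=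
  spec_class (Uqu_orbit_submod v) (Uqu_orbit_self v).

End ModUqPrime.

(* Main.v *)
From mathcomp Require Import all_boot all_order all_algebra.
From mathcomp Require Import boolp classical_sets reals.
From mathcomp.multinomials Require Import monalg.
From mathcomp.real_closed Require Import complex.
Require Import Defs.

(** Write [A] for the local ring of rational functions without pole at [u = 1]:
    a discrete valuation ring with uniformizer [u - 1] ([localA_dvr]), and let
    [W] be the [K]-form given by membership in [in_Mod_Uq'].  The argument works
    over any field [K].

    Everything rests on the finite generation over [A] of the weight spaces of
    [U.v], with [U = Uq (x) A].  As [A] is Noetherian ([fin_gen_submod]), it is
    enough that the denominators of the vectors of [U.v] of a given weight are
    bounded with respect to the lattice [A.W], whose weight spaces are finitely
    generated.

    The [h_{i,m}] preserve the lattice.  A single family [(x^s_{i,r})_r]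
    introduces only bounded denominators on a weight space ([x_bound]), although
    the condition on [W] controls [x^s_{i,r + sm}] for [m >= 0] only, with data
    that depend on [r].  Indeed a quasi-polynomial sequence satisfies a linear
    recurrence whose constant term is a unit of [A], so that its first term is in
    the [A]-span of the later ones; by induction, going backwards, all the vectors
    [x^s_{i,r} z] lie in the [A]-span of the finitely many ones which describe the
    tail that starts at 0 ([quasi_poly_fin_gen]).

    It remains to see that only finitely many operators [x] are necessary to
    reach a given weight.  By the commutation of [x^+] with [x^-], every vector
    of [U.v] is a combination of vectors obtained from the weight components of
    [v] by some number [d] of operators [x^+], then some number [e] of operators
    [x^-], with operators [h] in between ([orbit_levels]).  Since the weights of
    [V] are bounded above, [d] is bounded; the final weight then bounds [e]
    ([level_bounded]).

    For the specialization: as [q] is not a root of unity, the [k_c] separate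
    weights, so that projections on weight spaces are given by elements of [Uq]
    ([weight_projector]).  Hence [U.v] is the sum of its weight spaces, and so is
    its specialization, whose weight spaces are the images of those of [U.v]
    ([spec_weight_lift]); the conditions on weights are inherited from [W].
    The specialization is cyclic because [A = K + (u - 1) A], and it is nonzero
    by Nakayama's lemma applied to a weight space of [U.v] ([spec_neq0]). *)

Set Implicit Arguments.
Unset Strict Implicit.
Unset Printing Implicit Defensive.
Import GRing.Theory Order.TTheory Num.Theory.
Local Open Scope classical_set_scope.
Local Open Scope ring_scope.

(** * Spans over a subring of the scalars *)

Section Spans.
Variables (L : fieldType) (V : lmodType L).
Implicit Types (P : set L) (S X : set V).

Lemma submod_sum P X (I : eqType) (r : seq I) (F : I -> V) :
  submod P X -> (forall i, i \in r -> X (F i)) -> X (\sum_(i <- r) F i).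
Proof.
by case=> X0 XD _ XF; rewrite big_seq; elim/big_ind: _.
Qed.

Lemma submod_preim P X (f : V -> V) :
  (forall x y, f (x + y) = f x + f y) -> (forall c x, f (c *: x) = c *: f x) ->
  submod P X -> submod P [set y | X (f y)].
Proof.
move=> fD fZ [X0 XD XZ]; split=> /= [|x y Xx Xy|a x Pa Xx].
- by rewrite -(scale0r 0) fZ scale0r.
- by rewrite fD; apply: XD.
- by rewrite fZ; apply: XZ.
Qed.

Lemma submod_scale_preim P X c : submod P X -> submod P [set y | X (c *: y)].
Proof.
apply: submod_preim => [x y|d x]; first exact: scalerDr.
by rewrite !scalerA mulrC.
Qed.

Lemma submodI P X Y : submod P X -> submod P Y -> submod P (X `&` Y).
Proof.
move=> [X0 XD XZ] [Y0 YD YZ]; split=> [|x y [Xx Yx] [Xy Yy]|a x Pa [Xx Yx]].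
- by split.
- by split; [apply: XD|apply: YD].
- by split; [apply: XZ|apply: YZ].
Qed.

Lemma span_min P S X : submod P X -> S `<=` X -> span_over P S `<=` X.
Proof.
move=> hX SX _ [t [tPS ->]]; apply: submod_sum (hX) _ => p /tPS[Pp /SX].
by case: hX => _ _; apply.
Qed.

Lemma span_subset P S : P 1 -> S `<=` span_over P S.
Proof.
move=> P1 x Sx; exists [:: (1, x)]; rewrite big_seq1 scale1r; split=> // p.
by rewrite inE => /eqP ->.
Qed.

Lemma span_submod P S : (forall a b, P a -> P b -> P (a * b)) ->
  submod P (span_over P S).
Proof.
move=> PM; split=> [|_ _ [t [tP ->]] [t' [tP' ->]]|a _ Pa [t [tP ->]]].
- by exists [::]; rewrite big_nil.
- exists (t ++ t'); rewrite big_cat; split=> // p.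
  by rewrite mem_cat => /orP[/tP|/tP'].
- exists [seq (a * p.1, p.2) | p <- t]; split.
    by move=> _ /mapP[p /tP[Pp Sp] ->]; split=> //; apply: PM.
  by rewrite big_map scaler_sumr; apply: eq_bigr => p _; rewrite scalerA.
Qed.

Lemma submod_weaken P P' X : P `<=` P' -> submod P' X -> submod P X.
Proof. by move=> PP' [X0 XD XZ]; split=> // a x /PP'; apply: XZ. Qed.

Lemma span_cons P (x : V) (t : seq V) y :
  (forall a b, P a -> P b -> P (a + b)) -> P 0 -> P 1 ->
  (forall a b, P a -> P b -> P (a * b)) ->
  span_over P [set` x :: t] y <->
  exists2 a, P a & span_over P [set` t] (y - a *: x).
Proof.
move=> PD P0 P1 PM; have [T0 TD TZ] := span_submod [set` t] PM; split.
- pose X := [set y | exists2 a, P a & span_over P [set` t] (y - a *: x)].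
  apply: (@span_min _ _ X) => [|z]; first split.
  + by exists 0 => //; rewrite scale0r subr0.
  + move=> z z' [a Pa h] [a' Pa' h']; exists (a + a'); first exact: PD.
    by rewrite scalerDl opprD addrACA; apply: TD.
  + move=> b z Pb [a Pa h]; exists (b * a); first exact: PM.
    by rewrite -scalerA -scalerBr; apply: TZ.
  + rewrite /= inE => /orP[/eqP -> |zt].
      by exists 1 => //; rewrite scale1r subrr.
    by exists 0 => //; rewrite scale0r subr0; apply: span_subset.
- move=> [a Pa h]; have [_ UD UZ] := span_submod [set` x :: t] PM.
  rewrite -[y](subrK (a *: x)); apply: UD.
    move: h; apply: span_min => [|z zt]; first exact: span_submod.
    by apply: span_subset; rewrite //= inE zt orbT.
  by apply: UZ => //; apply: span_subset; rewrite //= inE eqxx.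
Qed.

End Spans.

(** * Discrete valuation rings *)

(** A subring of a field, seen as a set of scalars, which is a discrete valuation
    ring with uniformizer [pi] and has that field as its field of fractions.  The
    last three conditions are the forms of these properties used below:
    factorization, common denominators, and membership of [pi] in the Jacobson
    radical. *)
Record dvr (L : fieldType) (A : set L) (pi : L) : Prop := Dvr {
  dvr1 : A 1;
  dvrB : forall a b, A a -> A b -> A (a - b);
  dvrM : forall a b, A a -> A b -> A (a * b);
  dvr_pi : A pi;
  dvr_pi_neq0 : pi != 0;
  dvr_factor : forall a, A a -> a != 0 ->
    exists k b, [/\ b != 0, A b, A b^-1 & a = pi ^+ k * b];
  dvr_denominator : forall f, exists N, A (pi ^+ N * f);
  dvr_radical : forall a, A a -> 1 - pi * a != 0 /\ A (1 - pi * a)^-1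
}.

Section Dvr.
Variables (L : fieldType) (A : set L) (pi : L) (hA : dvr A pi).

Lemma dvr0 : A 0.
Proof. by rewrite -(subrr 1); apply: (dvrB hA); exact: (dvr1 hA). Qed.

Lemma dvrN a : A a -> A (- a).
Proof. by rewrite -sub0r; apply: (dvrB hA); exact: dvr0. Qed.

Lemma dvrD a b : A a -> A b -> A (a + b).
Proof. by move=> Aa /dvrN Ab; rewrite -[b]opprK; exact: (dvrB hA). Qed.

Lemma dvr_piX N : A (pi ^+ N).
Proof.
elim: N => [|N IH]; first by rewrite expr0; exact: (dvr1 hA).
by rewrite exprS; apply: (dvrM hA) => //; exact: (dvr_pi hA).
Qed.

Lemma dvr_piX_neq0 N : pi ^+ N != 0.
Proof. by rewrite expf_neq0 // (dvr_pi_neq0 hA). Qed.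

Variable V : lmodType L.
Implicit Types S X : set V.

Lemma dvr_span_submod S : submod A (span_over A S).
Proof. exact: span_submod (dvrM hA). Qed.

Lemma dvr_span_subset S : S `<=` span_over A S.
Proof. exact: span_subset (dvr1 hA). Qed.

Lemma dvr_span_cons (x : V) t y :
  span_over A [set` x :: t] y <-> exists2 a, A a & span_over A [set` t] (y - a *: x).
Proof.
apply: span_cons; [exact: dvrD|exact: dvr0|exact: (dvr1 hA)|exact: (dvrM hA)].
Qed.

Lemma submodB S x y : submod A S -> S x -> S y -> S (x - y).
Proof.
move=> [_ SD SZ] Sx Sy; rewrite -scaleN1r; apply: SD => //; apply: SZ => //.
by apply: dvrN; exact: (dvr1 hA).
Qed.

(** Discrete valuation rings are Noetherian: by induction on the number of
    generators, since the coefficients of the elements of [S] on the first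
    generator form an ideal, generated by any of its elements of smallest
    valuation. *)
Lemma fin_gen_submod S (t : seq V) :
  submod A S -> S `<=` span_over A [set` t] -> fin_gen A S.
Proof.
elim: t S => [|x t IH] S hS St; first by exists [::].
have [S0 SD SZ] := hS.
have [t' t'S St'] : fin_gen A (S `&` span_over A [set` t]).
  apply: IH => [|y []//]; apply: submodI => //; exact: dvr_span_submod.
(* [y] has a coefficient of valuation [k] on the first generator. *)
pose lead k y b :=
  [/\ S y, b != 0, A b, A b^-1 & span_over A [set` t] (y - (pi ^+ k * b) *: x)].
have leadP y : S y ->
    span_over A [set` t] y \/ exists k b, lead k y b.
  move=> Sy; have /dvr_span_cons[a Aa ya] := St y Sy.
  have [a0|a0] := eqVneq a 0; first by left; move: ya; rewrite a0 scale0r subr0.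
  right; have [k [b [b0 Ab Ab' aE]]] := dvr_factor hA Aa a0.
  by exists k, b; rewrite /lead -aE.
pose Q k := `[< exists y b, lead k y b >].
have [exQ|nQ] := pselect (exists k, Q k); last first.
  exists t' => [y /t'S[]//|y Sy]; apply: St'; split=> //.
  case: (leadP y Sy) => // -[k [b kyb]].
  by case: nQ; exists k; apply/asboolP; exists y, b.
case: (ex_minnP exQ) => k /asboolP[y0 [b0 [Sy0 b00 _ Ab0 ya0]]] kmin.
exists (y0 :: t') => [y|y Sy].
  by rewrite /= inE => /orP[/eqP ->//|/t'S[]].
suff [d Ad ad] : exists2 d, A d & span_over A [set` t] (y - d *: y0).
  apply/dvr_span_cons; exists d => //; apply: St'; split=> //.
  by apply: submodB => //; apply: SZ.
case: (leadP y Sy) => [yt|[k' [b lead_y]]].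
  by exists 0; rewrite ?scale0r ?subr0 //; exact: dvr0.
have kk : (k <= k')%N by apply: kmin; apply/asboolP; exists y, b.
have [_ _ Ab _ ya] := lead_y.
exists (pi ^+ (k' - k) * b / b0).
  by apply: (dvrM hA) => //; apply: (dvrM hA) => //; exact: dvr_piX.
set d := _ / b0; have dE : d * (pi ^+ k * b0) = pi ^+ k' * b.
  rewrite /d -[in RHS](subnK kk) exprD -!mulrA; congr (_ * _).
  by rewrite [_ * b0]mulrC mulKf // mulrC.
rewrite [X in span_over _ _ X](_ : _ =
  (y - (pi ^+ k' * b) *: x) - d *: (y0 - (pi ^+ k * b0) *: x)).
  apply: submodB; [exact: dvr_span_submod|exact: ya|].
  have [_ _ TZ] := dvr_span_submod [set` t]; apply: TZ => //.
  by apply: (dvrM hA) => //; apply: (dvrM hA) => //; exact: dvr_piX.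
by rewrite scalerBr scalerA dE opprB addrA subrK.
Qed.

(** Nakayama's lemma, by elimination of the generators one by one: if
    [x = pi *: x'] with [x'] in [a *: x] plus the span of the other generators,
    then [(1 - pi * a) *: x] is in that span and [1 - pi * a] is a unit. *)
Lemma nakayama S : submod A S -> fin_gen A S ->
  (forall y, S y -> exists2 z, S z & y = pi *: z) -> S `<=` [set 0].
Proof.
move=> hS [t tS St] div.
elim: t tS St => [|x t IH] tS St.
  move=> y /St; apply: span_min => //; split=> //= [_ _ -> ->|a _ _ ->].
    by rewrite addr0.
  by rewrite scaler0.
apply: IH => [y yt|y /St]; first by apply: tS; rewrite /= inE yt orbT.
apply: span_min; first exact: dvr_span_submod.
move=> z; rewrite /= inE => /orP[/eqP ->|zt]; last exact: dvr_span_subset.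
have Sx : S x by apply: tS; rewrite /= inE eqxx.
have [x' /St/dvr_span_cons[a Aa x'a] xE] := div _ Sx.
have [n0 An] := dvr_radical hA Aa.
have [_ _ TZ] := dvr_span_submod [set` t].
rewrite -[x](scalerK n0); apply: (TZ) => //.
rewrite scalerBl scale1r -scalerA [in X in X - _]xE -scalerBr; apply: TZ => //.
exact: (dvr_pi hA).
Qed.

(** A vector is a combination of finitely many elements of [S], whose
    coefficients have a common denominator [pi ^+ N]. *)
Lemma span_denominator S (y : V) : submod A S -> span_over setT S y ->
  exists N, S (pi ^+ N *: y).
Proof.
move=> [S0 SD SZ] [t [tS ->]].
elim: t tS => [|p t IH] tS; first by exists 0%N; rewrite big_nil scaler0.
have [|N SN] := IH; first by move=> p' p't; apply: tS; rewrite inE p't orbT.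
have [N' AN'] := dvr_denominator hA p.1.
have [|_ Sp] := tS p; first by rewrite inE eqxx.
exists (N + N')%N; rewrite big_cons scalerDr exprD; apply: SD.
  by rewrite scalerA -mulrA; apply: SZ => //; apply: (dvrM hA) => //; exact: dvr_piX.
by rewrite mulrC -scalerA; apply: SZ => //; exact: dvr_piX.
Qed.

End Dvr.

(** * The local ring at u = 1 *)

Section LocalRing.
Variable K : fieldType.
Local Notation ratfun := {fraction {poly K}}.
Local Notation "p %:F" := (@tofrac {poly K} p).
Local Notation A := (@localA K).
Local Notation u := (uvar K).

Lemma uvar_neq0 : u != 0.
Proof. by rewrite tofrac_eq0 polyX_eq0. Qed.

Lemma horner1_neq0 (p : {poly K}) : p.[1] != 0 -> p%:F != 0.
Proof. by rewrite tofrac_eq0; apply: contraNneq => ->; rewrite horner0. Qed.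

Lemma localAP a :
  A a <-> exists p r : {poly K}, r.[1] != 0 /\ a = p%:F / r%:F.
Proof.
split=> [[f [g [c [[p [k ->]] [r [l [-> rc]]] c0 ->]]]]|[p [r [r1 ->]]]].
- exists (p * 'X^l), ('X^k * r); rewrite !hornerE expr1n mul1r rc; split=> //.
  by rewrite !rmorphM !rmorphXn /= invf_div mulf_div.
- exists p%:F, r%:F, r.[1]; split=> //.
    by exists p, 0%N; rewrite expr0 divr1.
  by exists r, 0%N; rewrite expr0 divr1.
Qed.

Lemma localA_sub a b : A a -> A b -> A (a - b).
Proof.
move=> /localAP[p [r [r1 ->]]] /localAP[p' [r' [r1' ->]]].
apply/localAP; exists (p * r' - p' * r), (r * r').
rewrite hornerM mulf_neq0// rmorphB !rmorphM /=; split=> //.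
by rewrite -[- (p'%:F / _)]mulNr addf_div ?horner1_neq0 // mulNr.
Qed.

Lemma localA_poly (p : {poly K}) : A p%:F.
Proof. by apply/localAP; exists p, 1; rewrite hornerC oner_eq0 divr1. Qed.

Lemma localA_uvar1 : A (u - 1).
Proof. by rewrite -[1](rmorph1 (@tofrac {poly K})) -rmorphB; exact: localA_poly. Qed.

Lemma uvar1E : u - 1 = ('X - 1%:P)%:F.
Proof. by rewrite rmorphB /= rmorph1. Qed.

Lemma uvar1_neq0 : u - 1 != 0.
Proof. by rewrite uvar1E tofrac_eq0 polyXsubC_eq0. Qed.

Lemma laurent_localA f : laurent f -> A f.
Proof.
move=> [p [k ->]]; apply/localAP; exists p, 'X^k.
by rewrite hornerXn expr1n oner_eq0 rmorphXn.
Qed.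

(** Evaluation at [u = 1]: the residue field of the local ring is [K]. *)
Lemma localA_residue a : A a ->
  exists c b, A b /\ a = ratfun_const c + (u - 1) * b.
Proof.
move=> /localAP[p [r [r1 ->]]]; exists (p.[1] / r.[1]).
have /factor_theorem[s ps] : poly.root (p - (p.[1] / r.[1])%:P * r) 1.
  by rewrite /poly.root !hornerE divfK ?subrr.
exists (s%:F / r%:F); split; first by apply/localAP; exists s, r.
have pE : p%:F = (p.[1] / r.[1])%:P%:F * r%:F + (u - 1) * s%:F.
  rewrite uvar1E -!rmorphM -rmorphD; congr _%:F.
  by rewrite [_ * s]mulrC -ps addrC subrK.
by rewrite [in LHS]pE mulrDl mulfK ?horner1_neq0 // mulrA.
Qed.

Lemma ratfun_quotient (f : ratfun) :
  exists p r : {poly K}, r != 0 /\ f = p%:F / r%:F.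
Proof.
pose x : {ratio {poly K}} := generic_quotient.repr f; exists (frac x).1, (frac x).2.
have d0 := denom_ratioP x; split=> //.
suff <- : f * (frac x).2%:F = (frac x).1%:F by rewrite mulfK // tofrac_eq0.
rewrite -[f in LHS]generic_quotient.reprK -/x; unlock tofrac.
rewrite -[LHS]FracField.pi_mul; apply/generic_quotient.eqmodP.
rewrite /= FracField.equivfE /FracField.mulf !numden_Ratio ?mulf_neq0 ?oner_eq0 //.
by rewrite !mulr1 mulrC.
Qed.

Lemma localA_unit_residue b : A b -> 1 - (u - 1) * b != 0 /\ A (1 - (u - 1) * b)^-1.
Proof.
move=> /localAP[p [r [r1 ->]]].
have rF := horner1_neq0 r1.
have E : 1 - (u - 1) * (p%:F / r%:F) = (r - ('X - 1%:P) * p)%:F / r%:F.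
  by rewrite uvar1E [in RHS]rmorphB [in RHS]rmorphM /= mulrBl divff // mulrA.
have n1 : (r - ('X - 1%:P) * p).[1] != 0.
  by rewrite !hornerE subrr mul0r subr0.
rewrite E invf_div; split; last by apply/localAP; exists r, (r - ('X - 1%:P) * p).
by rewrite mulf_neq0 ?invr_eq0 ?horner1_neq0.
Qed.

Lemma localA_dvr : dvr A (u - 1).
Proof.
split.
- exact: localA1.
- exact: localA_sub.
- exact: localA_mul.
- exact: localA_uvar1.
- exact: uvar1_neq0.
- move=> a /localAP[p [r [r1 ->]]]; rewrite mulf_eq0 invr_eq0 negb_or tofrac_eq0.
  case/andP=> p0 _; have [k [p' + pE]] := multiplicity_XsubC p 1.
  rewrite p0 /poly.root /= => p1; exists k, (p'%:F / r%:F); split.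
  + by rewrite mulf_neq0 ?invr_eq0 ?horner1_neq0.
  + by apply/localAP; exists p', r.
  + by apply/localAP; exists r, p'; rewrite invf_div.
  + by rewrite uvar1E pE rmorphM rmorphXn mulrA [_ * p'%:F]mulrC.
- move=> f; have [p [r [r0 ->]]] := ratfun_quotient f.
  have [l [r' + rE]] := multiplicity_XsubC r 1; rewrite r0 /poly.root /= => r1.
  exists l; apply/localAP; exists p, r'; split; first exact: r1.
  have n0 : ('X - 1%:P)%:F ^+ l != 0 by rewrite expf_neq0 // -uvar1E uvar1_neq0.
  rewrite uvar1E rE rmorphM rmorphXn invfM mulrCA; congr (_ * _).
  by rewrite mulrCA divff // mulr1.
- exact: localA_unit_residue.
Qed.

End LocalRing.

(** * Subalgebras and generators *)

Section Subalgebras.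
Variables (K : fieldType) (A : algType K) (S : set A) (hS : subalgebra S).

Lemma subalgebra0 : S 0.
Proof.
case: hS => S1 SD _; have := SD (-1) 1 1 S1 S1.
by rewrite scaleN1r addNr.
Qed.

Lemma subalgebraD a b : S a -> S b -> S (a + b).
Proof. by case: hS => _ SD _ Sa Sb; rewrite -[a]scale1r; apply: SD. Qed.

Lemma subalgebraZ c a : S a -> S (c *: a).
Proof.
case: hS => _ SD _ Sa; rewrite -[_ *: _]addr0; apply: SD => //; exact: subalgebra0.
Qed.

Lemma subalgebraM a b : S a -> S b -> S (a * b).
Proof. by case: hS => _ _; apply. Qed.

Lemma subalgebra_sum (I : Type) (r : seq I) (P : pred I) (F : I -> A) :
  (forall i, P i -> S (F i)) -> S (\sum_(i <- r | P i) F i).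
Proof.
move=> SF; elim/big_ind: _ => //; first exact: subalgebra0.
exact: subalgebraD.
Qed.

(** The coefficients of an exponential are polynomials in those of its
    argument. *)
Lemma subalgebra_phi n (D : cartan_datum n) (q : q_param K)
    (k : cartan_h D -> A) (h : 'I_n -> nzint -> A) s i m :
  (forall c, S (k c)) -> (forall i m, S (h i m)) -> S (phi q k h s i m).
Proof.
move=> Sk Sh; have S_powers l e : S ((h_series q h s i m ^+ l)`_e).
  elim: l e => [|l IH] e.
    by rewrite expr0 coef1; case: eqP => _; [case: hS|exact: subalgebra0].
  rewrite exprS coefM; apply: subalgebra_sum => j _; apply: subalgebraM => //.
  rewrite coef_poly; case: ifP => _; last exact: subalgebra0.
  by case: (nat_of_ord j) => [|j']; [exact: subalgebra0|exact: subalgebraZ].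
apply: subalgebraM => //; apply: subalgebra_sum => p _; exact: subalgebraZ.
Qed.

End Subalgebras.

Lemma smallest_subalgebra (K : fieldType) (A : algType K) (G : set A) :
  subalgebra (smallest (@subalgebra K A) G).
Proof.
split=> [T [[]]//|c a b Sa Sb T hT|a b Sa Sb T hT]; have [[_ TD TM] _] := hT.
  by apply: TD; [exact: Sa|exact: Sb].
by apply: TM; [exact: Sa|exact: Sb].
Qed.

(** Words are products of generators and span the free algebra. *)
Lemma free_alg_ind (K : fieldType) (G : choiceType) (S : set (free_alg K G)) :
  subalgebra S -> (forall g, S (free_gen K g)) -> forall a, S a.
Proof.
move=> hS Sg a; rewrite [a]monalgE; apply: (subalgebra_sum hS) => m _.
rewrite (_ : << a@_m *g m >> = a@_m *: << m >>); last first.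
  by apply/malgP => k; rewrite mcoeffZ !mcoeffU mulrnAr mulr1.
apply: (subalgebraZ hS); case: m => s; elim: s => [|g s IH].
  rewrite (_ : << _ >> = 1); first by case: hS.
  by congr << _ >>; apply: val_inj; rewrite /= fm1.
rewrite (_ : << _ >> = free_gen K g * << FMonom s >>).
  exact: (subalgebraM hS).
rewrite /free_gen malgM_def fgmulUU mulr1; congr << _ >>; apply: val_inj => /=.
by rewrite fmM fmuE.
Qed.

Section Generators.
Variables (K : fieldType) (n : nat) (D : cartan_datum n) (q : q_param K).
Local Notation U := (Uq D q).

(** The projection onto [Uq], typed so that its values carry the algebra
    structure of [Uq] itself. *)
Definition Uq_pi (a : free_alg K (gen D)) : U := quot_pi (Uq_proper (D := D) (q := q)) a.
Local Notation pi := Uq_pi.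
Local Notation x := (Ux D q).
Local Notation k := (@Uk K n D q).
Local Notation h := (Uh D q).

Lemma Uq_piZ c a : pi (c *: a) = c *: pi a.
Proof. exact: quot_pi_scale. Qed.

Lemma Uq_piM a b : pi (a * b) = pi a * pi b.
Proof. exact: quot_pi_mul. Qed.

Lemma Uq_piD a b : pi (a + b) = pi a + pi b.
Proof. exact: quot_piD. Qed.

Lemma Uq_piB a b : pi (a - b) = pi a - pi b.
Proof. by rewrite -[- b]scaleN1r Uq_piD Uq_piZ scaleN1r. Qed.

Lemma Uq_pi_comm a b : pi (a * b - b * a) = pi a * pi b - pi b * pi a.
Proof. by rewrite Uq_piB !Uq_piM. Qed.

(** The Cartan part is taken in the free algebra, where the right-hand sides of
    the defining relations are written. *)
Definition free_hhat : set (free_alg K (gen D)) :=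
  smallest (@subalgebra K (free_alg K (gen D)))
    [set a | (exists c, a = fk K c) \/ exists i m, a = fh K D i m].

Lemma free_hhat_phi s i m : free_hhat (phi q (@fk K n D) (fh K D) s i m).
Proof.
apply: (subalgebra_phi (smallest_subalgebra _)) => [c|j p].
  by apply: sub_gen_smallest; left; exists c.
by apply: sub_gen_smallest; right; exists j, p.
Qed.

Lemma free_hhat_phi_int s i t : free_hhat (phi_int q (@fk K n D) (fh K D) s i t).
Proof.
rewrite /phi_int; case: ifP => _; first exact: free_hhat_phi.
exact: subalgebra0 (smallest_subalgebra _).
Qed.

Lemma Uq_rel a b :
  affine_rel q (fx K D) (@fk K n D) (fh K D) a b -> pi a = pi b.
Proof.
by move=> ab; apply/quot_pi_eq; apply: sub_gen_smallest; exists a, b.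
Qed.

Lemma Uq_ind (S : set U) : subalgebra S -> (forall s i r, S (x s i r)) ->
  (forall c, S (k c)) -> (forall i m, S (h i m)) -> forall a, S a.
Proof.
move=> [S1 SD SM] Sx Sk Sh a; elim/quot_ind: a => a.
rewrite -[quot_pi _ _]/(pi a); apply: (@free_alg_ind K (gen D) [set a | S (pi a)]) a.
  split=> //= [c a b Sa Sb|a b Sa Sb].
    by rewrite Uq_piD Uq_piZ; apply: SD.
  by rewrite Uq_piM; apply: SM.
move=> [[[[s i] r]|c]|[i m]]; [exact: Sx|exact: Sk|exact: Sh].
Qed.

Lemma Uq_kD c c' : k c * k c' = k (c + c').
Proof. by rewrite -[LHS]Uq_piM; apply: Uq_rel; exact: rel_kD. Qed.

Lemma Uq_k0 : k 0 = 1.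
Proof. by apply: Uq_rel; exact: rel_k0. Qed.

Lemma Uq_kh c i m : k c * h i m = h i m * k c.
Proof. by rewrite -[LHS]Uq_piM -[RHS]Uq_piM; apply: Uq_rel; exact: rel_kh. Qed.

Lemma Uq_kx s c j r :
  k c * x s j r = q ((sgn s)%:~R * root D j c) *: (x s j r * k c).
Proof.
have := Uq_rel (rel_kx q (fx K D) (@fk K n D) (fh K D) s c j r).
rewrite Uq_piZ Uq_piM (Uq_piM (fk K c)) => /(congr1 (fun a => a * k c)).
by rewrite -mulrA Uq_kD addNr Uq_k0 mulr1 -scalerAl.
Qed.

Lemma Uq_hx s i m j r : exists c,
  h i m * x s j r = x s j r * h i m + c *: x s j (val m + r).
Proof.
have := Uq_rel (rel_hx q (fx K D) (@fk K n D) (fh K D) s i m j r).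
rewrite Uq_piZ (Uq_pi_comm (fh K D i m) (fx K D s j r)) => hx; eexists.
by rewrite -[LHS](subrK (x s j r * h i m)) addrC; congr (_ + _); exact: hx.
Qed.

Lemma Uq_xx i r j t : exists2 a, free_hhat a &
  x true i r * x false j t = x false j t * x true i r + pi a.
Proof.
have := Uq_rel (rel_xx q (fx K D) (@fk K n D) (fh K D) i j r t).
rewrite (Uq_pi_comm (fx K D true i r) (fx K D false j t)).
set a := (if _ then _ else _) => xx; exists a.
  have hS := smallest_subalgebra [set a | (exists c, a = @fk K n D c) \/
                                       exists i m, a = fh K D i m].
  rewrite /a; case: ifP => _; last exact: (subalgebra0 hS).
  apply: (subalgebraZ hS); rewrite -scaleN1r; apply: (subalgebraD hS).
    exact: free_hhat_phi_int.
  by apply: (subalgebraZ hS); exact: free_hhat_phi_int.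
by rewrite -xx addrC subrK.
Qed.

End Generators.

(** * Weights *)

Section Qpow.
Variables (K : fieldType) (q : q_param K).

Lemma qpow_neq0 s : q s != 0.
Proof.
apply: contra_neq (q_neq0 q) => qs.
by rewrite -[X in q X](subrK s) qpowD qs mulr0.
Qed.

Lemma qpow0 : q 0 = 1.
Proof. by apply: (mulfI (qpow_neq0 0)); rewrite -qpowD addr0 mulr1. Qed.

Lemma qpowMn s m : q (s *+ m) = q s ^+ m.
Proof.
by elim: m => [|m IH]; rewrite ?mulr0n ?qpow0 ?expr0 // mulrS qpowD exprS IH.
Qed.

Lemma qpowN s : q (- s) = (q s)^-1.
Proof.
apply: (mulfI (qpow_neq0 s)); rewrite -qpowD subrr qpow0 divff //.
exact: qpow_neq0.
Qed.

(** A nonzero rational power of a non root of unity is not 1: raise it to the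
    denominator of the exponent. *)
Lemma qpow_eq1 s : q s = 1 -> s = 0.
Proof.
move=> qs; apply/eqP; rewrite -numq_eq0; apply/negP => /negP s0.
have q1 : q (numq s)%:~R = 1.
  rewrite numqE; case: (denq s) (denq_ge0 s) => // d _.
  by rewrite -pmulrn mulr_natr qpowMn qs expr1n.
have := q_not_root1 q (m := `|numq s|%N); rewrite absz_gt0 => /(_ s0)/eqP; apply.
rewrite -qpowMn; case: (numq s) q1 => m; rewrite ?NegzE ?abszN /=.
  by rewrite -pmulrn.
by rewrite mulrNz qpowN -pmulrn => /eqP; rewrite invr_eq1 => /eqP.
Qed.

Lemma qpow_inj : injective q.
Proof.
move=> s t st; apply: subr0_eq; apply: qpow_eq1.
by rewrite qpowD st qpowN divff // qpow_neq0.
Qed.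

End Qpow.

Section WeightSpaces.
Variables (K : fieldType) (n : nat) (D : cartan_datum n) (q : q_param K).
Variables (L : fieldType) (iota : {rmorphism K -> L}) (V : lmodType L).
Variable M : rep (Uq D q) iota V.
Local Notation weight := 'Hom(cartan_h D, rat^o).
Local Notation wt := (weight_space M).
Implicit Types (w : weight) (X : set V).

Lemma act0 a : M a 0 = 0.
Proof. by rewrite -(scale0r 0) actZ !scale0r. Qed.

Lemma act_sum a (I : Type) (r : seq I) (P : pred I) (F : I -> V) :
  M a (\sum_(i <- r | P i) F i) = \sum_(i <- r | P i) M a (F i).
Proof. exact: (big_morph (M a) (actD M a) (act0 a)). Qed.

Lemma submod_act_preim P X a : submod P X -> submod P [set y | X (M a y)].
Proof. by apply: submod_preim => *; [exact: actD|exact: actZ]. Qed.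

Lemma weight_submod P w : submod P (wt w).
Proof.
split=> [c|y z wy wz c|a y _ wy c]; first by rewrite act0 scaler0.
- by rewrite actD wy wz scalerDr.
- by rewrite actZ wy !scalerA mulrC.
Qed.

Lemma weight_x s i r w y : wt w y -> wt (w + root D i *~ sgn s) (M (Ux D q s i r) y).
Proof.
move=> wy c; rewrite -actM Uq_kx act_scalel actM wy actZ scalerA -rmorphM.
congr (iota _ *: _); rewrite add_lfunE mulrC -qpowD; congr (q (_ + _)).
by case: s; rewrite /sgn /= ?mul1r // ?mulN1r mulrN1z opp_lfunE.
Qed.

Lemma weight_h i m w y : wt w y -> wt w (M (Uh D q i m) y).
Proof. by move=> wy c; rewrite -actM Uq_kh actM wy actZ. Qed.

(** Lagrange interpolation in the [k_c], whose eigenvalues separate weights. *)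
Lemma weight_projector w (ws : seq weight) : exists a : Uq D q,
  (forall y, wt w y -> M a y = y) /\
  (forall w', w' \in ws -> w' != w -> forall y, wt w' y -> M a y = 0).
Proof.
elim: ws => [|w' ws [a [aw a0]]]; first by exists 1; split=> // y _; rewrite act1.
have [w'w|w'w] := eqVneq w' w.
  exists a; split=> // w''; rewrite inE => /orP[/eqP -> |/a0//].
  by rewrite w'w eqxx.
have [c wc] : exists c, w c != w' c.
  apply: contrapT => /forallNP wc; case/eqP: w'w; apply/lfunP => c.
  by apply/esym/eqP/negbNE/negP/wc.
have qc : q (w c) - q (w' c) != 0 by rewrite subr_eq0; apply: contra_neq wc => /qpow_inj.
pose b : Uq D q := (q (w c) - q (w' c))^-1 *: (Uk q c - q (w' c) *: 1).
have bE w'' y : wt w'' y -> M b y = iota ((q (w c) - q (w' c))^-1 * (q (w'' c) - q (w' c))) *: y.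
  move=> wy; rewrite act_scalel -scaleN1r act_addl !act_scalel act1 wy.
  by rewrite rmorphN1 scaleN1r -scalerBl scalerA -rmorphB -rmorphM.
exists (a * b); split=> [y wy|w''].
  by rewrite actM (bE w) // mulVf // rmorph1 scale1r aw.
rewrite inE => /orP[/eqP -> _ y wy|/a0 aw'' w''w y wy].
  by rewrite actM (bE w') // subrr mulr0 rmorph0 scale0r act0.
by rewrite actM (bE w'') // actZ aw'' // scaler0.
Qed.

Lemma projector_sum a w (I : eqType) (r : seq I) (g : I -> weight) (F : I -> V) :
  (forall y, wt w y -> M a y = y) ->
  (forall w', w' \in [seq g i | i <- r] -> w' != w -> forall y, wt w' y -> M a y = 0) ->
  (forall i, i \in r -> wt (g i) (F i)) ->
  M a (\sum_(i <- r) F i) = \sum_(i <- r | g i == w) F i.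
Proof.
move=> aw a0 gF; rewrite act_sum [LHS]big_seq [RHS]big_seq_cond big_mkcondr /=.
apply: eq_bigr => i ir; case: eqP => [giw|/eqP giw].
  by apply: aw; rewrite -giw; exact: gF.
by apply: (a0 (g i)) => //; [exact: map_f|exact: gF].
Qed.

(** The projector on the weight space of [w] fixes [y] and annihilates the terms
    of other weights in an expression of [y]. *)
Lemma span_graded P (S : weight -> set V) w y :
  (forall w, S w `<=` wt w) -> span_over P [set z | exists w, S w z] y ->
  wt w y -> span_over P (S w) y.
Proof.
move=> SV [t [tS yE]] wy.
have /choice[g gS] : forall p : L * V, exists w, p \in t -> S w p.2.
  move=> p; have [pt|pt] := boolP (p \in t); last by exists 0.
  by have [_ [w' Sw']] := tS p pt; exists w'.
have [a [aw a0]] := weight_projector w [seq g p | p <- t].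
exists [seq p <- t | g p == w]; split.
  move=> p; rewrite mem_filter => /andP[/eqP pw pt].
  by split; [have [] := tS p pt|rewrite -pw; exact: gS].
rewrite -[LHS]aw // yE (projector_sum (g := g) aw) ?big_filter //.
move=> p pt; have [_ _ VZ] := weight_submod setT (g p).
by apply: VZ => //; apply: SV; exact: gS.
Qed.

Lemma weight_independent (m : nat) (i : 'I_m -> weight) (x : 'I_m -> V) :
  injective i -> (forall j, wt (i j) (x j)) -> \sum_j x j = 0 -> forall j, x j = 0.
Proof.
move=> i_inj ix x0 j.
have [a [aw a0]] := weight_projector (i j) [seq i j | j <- index_enum 'I_m].
have := projector_sum aw a0 (fun j _ => ix j).
rewrite x0 act0 (eq_bigl (pred1 j)) ?big_pred1_eq // => j' /=.
exact: (inj_eq i_inj).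
Qed.

(** Submodules are graded, because the projectors on weight spaces are given by
    elements of the algebra. *)
Lemma weight_components X (s : seq (weight * V)) :
  (forall a y, X y -> X (M a y)) -> (forall p, p \in s -> wt p.1 p.2) ->
  X (\sum_(p <- s) p.2) -> exists s' : seq (weight * V),
    (forall p, p \in s' -> wt p.1 p.2 /\ X p.2) /\
    \sum_(p <- s) p.2 = \sum_(p <- s') p.2.
Proof.
move=> hX sV Xs; pose ws := [seq p.1 | p <- s].
have /choice[e eP] : forall w, exists a : Uq D q,
  (forall y, wt w y -> M a y = y) /\
  (forall w', w' \in ws -> w' != w -> forall y, wt w' y -> M a y = 0).
  by move=> w; exact: weight_projector.
have eE w : M (e w) (\sum_(p <- s) p.2) = \sum_(p <- s | p.1 == w) p.2.
  by have [ew e0] := eP w; exact: projector_sum.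
exists [seq (w, M (e w) (\sum_(p <- s) p.2)) | w <- undup ws]; split.
  move=> _ /mapP[w _ ->] /=; split; last exact: hX.
  rewrite eE big_seq_cond -big_filter.
  apply: (submod_sum (weight_submod setT w)) => p.
  by rewrite mem_filter => /andP[/andP[ps /eqP <-] _]; exact: sV.
rewrite big_map /=; under [RHS]eq_bigr do rewrite eE.
rewrite (exchange_big_dep xpredT) //= big_seq [RHS]big_seq; apply: eq_bigr => p ps.
rewrite (eq_bigl (pred1 p.1)); last by move=> w; rewrite /= eq_sym.
by rewrite -big_filter filter_pred1_uniq ?undup_uniq ?mem_undup ?map_f // big_seq1.
Qed.

End WeightSpaces.

(** * Quasi-polynomial sequences *)

Section Euler.
Variable L : fieldType.
Implicit Types p r : {poly L}.

(** The operator [X d/dX] multiplies the coefficient of degree [j] by [j]: its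
    [k]-th power turns the value at [c] into the pairing of [p] with the sequence
    [c ^+ j * j ^ k]. *)
Definition euler_op p := 'X * p^`().

Lemma coef_iter_euler k p j : (iter k euler_op p)`_j = p`_j *+ (j ^ k).
Proof.
elim: k => [|k IH]; first by rewrite expn0.
rewrite iterS coefXM coef_deriv; case: j IH => [|j] IH /=.
  by rewrite exp0n.
by rewrite IH -mulrnA expnSr.
Qed.

Lemma horner_iter_euler k p c :
  (iter k euler_op p).[c] = \sum_(j < size p) p`_j * (c ^+ j * (j ^ k)%:R).
Proof.
rewrite (@horner_coef_wide _ (size p)); last first.
  by apply/leq_sizeP => j pj; rewrite coef_iter_euler nth_default // mul0rn.
apply: eq_bigr => j _; rewrite coef_iter_euler.
by rewrite mulr_natr mulrnAr mulrnAl.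
Qed.

(** A derivation lowers the multiplicity of a root by at most one. *)
Lemma iter_euler_root k p r c :
  p = r * ('X - c%:P) ^+ k.+1 -> (iter k euler_op p).[c] = 0.
Proof.
suff H e : p = r * ('X - c%:P) ^+ (k + e) ->
    exists r', iter k euler_op p = r' * ('X - c%:P) ^+ e.
  rewrite -addn1 => /H[r' ->]; by rewrite !hornerE subrr mulr0.
elim: k e => [|k IH] e pE; first by exists r.
have [|r' rE] := IH e.+1; first by rewrite addnS -addSn.
rewrite iterS rE; exists ('X * (r'^`() * ('X - c%:P) + r' *+ e.+1)).
rewrite /euler_op derivM deriv_exp derivXsubC mul1r -mulrA; congr (_ * _).
by rewrite mulrDl exprS mulrA mulrnAr mulrnAl.
Qed.

End Euler.

Section QuasiPolynomial.
Variables (L : fieldType) (A : set L) (pi : L) (hA : dvr A pi) (V : lmodType L).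
Implicit Types (X : set V) (b : nat -> V).

Definition polyA (p : {poly L}) := forall i, A p`_i.

Lemma polyA_mul p r : polyA p -> polyA r -> polyA (p * r).
Proof.
move=> Ap Ar i; rewrite coefM; elim/big_ind: _ => [|x y|j _].
- exact: (dvr0 hA).
- exact: (dvrD hA).
- exact: (dvrM hA).
Qed.

Definition unitA c := [/\ c != 0, A c & A c^-1].

Lemma unitAM c c' : unitA c -> unitA c' -> unitA (c * c').
Proof.
move=> [c0 Ac Ac'] [d0 Ad Ad']; split; first by rewrite mulf_neq0.
  exact: (dvrM hA).
by rewrite invfM; exact: (dvrM hA).
Qed.

Lemma unitA1 : unitA 1.
Proof. by split; rewrite ?oner_neq0 ?invr1 //; exact: (dvr1 hA). Qed.

Lemma unitAN c : unitA c -> unitA (- c).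
Proof.
by case=> c0 Ac Ac'; split; rewrite ?oppr_eq0 // ?invrN; exact: (dvrN hA).
Qed.

Lemma unitAX c m : unitA c -> unitA (c ^+ m).
Proof.
move=> Uc; elim: m => [|m IH]; last by rewrite exprS; exact: unitAM.
by rewrite expr0; exact: unitA1.
Qed.

(** The product of the [('X - c_t) ^+ k_t.+1] is the characteristic polynomial of
    a recurrence satisfied by all the sequences [c_t ^+ m * m ^ k_t]; its constant
    term is a unit when the [c_t] are. *)
Lemma quasi_poly_recurrence (T : seq (L * nat)) :
  (forall t, t \in T -> unitA t.1) -> exists p,
    [/\ polyA p, unitA p`_0 & forall t, t \in T ->
        \sum_(j < size p) p`_j * (t.1 ^+ j * (j ^ t.2)%:R) = 0].
Proof.
move=> TU; pose fac (t : L * nat) := ('X - t.1%:P) ^+ t.2.+1.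
have facA t : t \in T -> polyA (fac t).
  move=> /TU[_ At _]; rewrite /fac; elim: t.2.+1 => [|m IH] i.
    by rewrite expr0 coef1; case: eqP => _; [exact: (dvr1 hA)|exact: (dvr0 hA)].
  rewrite exprS; apply: polyA_mul => // j.
  rewrite coefB coefX coefC; apply: (dvrB hA).
    by case: eqP => _; [exact: (dvr1 hA)|exact: (dvr0 hA)].
  by case: eqP => _ //; exact: (dvr0 hA).
exists (\prod_(t <- T) fac t); split.
- rewrite big_seq; elim/big_ind: _ => [i|p r|//].
    by rewrite coef1; case: eqP => _; [exact: (dvr1 hA)|exact: (dvr0 hA)].
  exact: polyA_mul.
- rewrite -horner_coef0 horner_prod big_seq.
  elim/big_ind: _ => [|x y|t tT]; [exact: unitA1|exact: unitAM|].
  rewrite horner_exp hornerXsubC sub0r; apply: unitAX; apply: unitAN; exact: TU.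
- move=> t tT; rewrite -horner_iter_euler.
  apply: (@iter_euler_root _ _ _ (\prod_(t' <- rem t T) fac t')).
  by rewrite (perm_big _ (perm_to_rem tT)) big_cons mulrC.
Qed.

Definition quasi_polynomial b := exists T : seq (L * nat * V),
  (forall t, t \in T -> unitA t.1.1) /\
  forall m, b m = \sum_(t <- T) (t.1.1 ^+ m * (m ^ t.1.2)%:R) *: t.2.

(** The recurrence can be solved for the first term, as its constant term is a
    unit. *)
Lemma quasi_poly_head b X : quasi_polynomial b -> submod A X ->
  (forall m, X (b m.+1)) -> X (b 0%N).
Proof.
move=> [T [TU bE]] hX Xb; have [_ _ XZ] := hX.
have [t /mapP[t' t'T ->]|p [pA [p0 Ap0 Ap0'] pT]] :=
  @quasi_poly_recurrence [seq t.1 | t <- T]; first exact: TU.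
have : \sum_(j < size p) p`_j *: b j = 0.
  under eq_bigr do rewrite bE scaler_sumr.
  rewrite exchange_big big_seq big1 // => t tT.
  under eq_bigr do rewrite scalerA.
  by rewrite -scaler_suml pT ?scale0r // map_f.
case sp : (size p) => [|N]; first by rewrite nth_default ?sp ?eqxx in p0.
rewrite big_ord_recl => /eqP; rewrite addr_eq0 => /eqP bp.
rewrite -(scalerK p0 (b 0%N)) bp; apply: (XZ) => //.
rewrite -scaleN1r; apply: (XZ); first by apply: (dvrN hA); exact: (dvr1 hA).
by apply: (submod_sum hX) => j _; apply: (XZ); [exact: pA|exact: Xb].
Qed.

(** The expressions of the various tails of the sequence need not be compared:
    the vectors of the expression for the tail starting at 0 span this tail, and
    by [quasi_poly_head] each earlier term is in the span of the later ones. *)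
Lemma quasi_poly_fin_gen (s : bool) (a : int -> V) :
  (forall r, quasi_polynomial (fun m => a (r + sgn s * m%:Z))) ->
  exists t : seq V, forall r, span_over A [set` t] (a r).
Proof.
move=> aq; have [T [TU aE]] := aq 0; exists [seq t.2 | t <- T].
set X := span_over _ _; have hX : submod A X by exact: (dvr_span_submod hA).
(* Induction on the starting point [- N] of the tail. *)
suff H N m : X (a (sgn s * (m%:Z - N%:Z))).
  move=> r; have [k [N ->]] : exists m N : nat, r = sgn s * (m%:Z - N%:Z).
    case: s {aq aE H}; case: r => m.
    - by exists m, 0%N; rewrite mul1r subr0.
    - by exists 0%N, m.+1; rewrite mul1r sub0r NegzE.
    - by exists 0%N, m; rewrite sub0r mulrNN mul1r.
    - by exists m.+1, 0%N; rewrite subr0 mulN1r NegzE.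
  exact: H.
elim: N m => [|N IH] m.
  rewrite subr0 -[sgn s * _]add0r aE; apply: (submod_sum hX) => t tT.
  have [_ _ XZ] := hX; apply: (XZ).
    apply: (dvrM hA); last first.
      elim: (m ^ _)%N => [|e]; first exact: (dvr0 hA).
      by rewrite mulrS; apply: (dvrD hA); exact: (dvr1 hA).
    by have [] := unitAX m (TU t tT).
  by apply: (dvr_span_subset hA); exact: map_f.
case: m => [|m]; last by rewrite -addn1 -[N.+1]addn1 !PoszD opprD addrACA subrr addr0.
have := quasi_poly_head (aq (sgn s * - (N.+1)%:Z)) hX; rewrite /= mulr0 addr0 sub0r; apply.
move=> m; rewrite -mulrDr addrC -addn1 -[N.+1]addn1 !PoszD opprD addrACA subrr addr0.
exact: IH.
Qed.

End QuasiPolynomial.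

(** * The lattice spanned by the form *)

Section Height.
Variables (n : nat) (D : cartan_datum n).

(** Since the simple roots are linearly independent, their values can be
    prescribed; evaluation at [rho] is then the height of weights. *)
Lemma exists_height : exists rho : cartan_h D, forall i, root D i rho = 1.
Proof.
pose b := vbasis {: cartan_h D}.
pose Q : 'M[rat]_(n, \dim {: cartan_h D}) := \matrix_(i, k) (root D i b`_k : rat).
have Qfree : row_free Q.
  apply: inj_row_free => c cQ; apply/rowP => i; rewrite mxE.
  have roots_free : free [tuple root D i | i < n] by exact: root_free.
  move: roots_free => /freeP; apply; move: i => _.
  apply/lfunP => y; rewrite (coord_vbasis (memvf y)) sum_lfunE zero_lfunE.
  under eq_bigr do rewrite linear_sum.
  rewrite exchange_big big1 // => k _.
  have /rowP/(_ k) := cQ; rewrite !mxE => cQk.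
  rewrite -[RHS](mulr0 (coord b k y)) -[in RHS]cQk mulr_sumr; apply: eq_bigr => j _.
  by rewrite mxE nth_mktuple linearZ /= scale_lfunE.
pose e : 'cV[rat]_(\dim {: cartan_h D}) := pinvmx Q *m (const_mx 1 : 'cV_n).
exists (\sum_k e k 0 *: b`_k) => i; rewrite linear_sum /=.
transitivity ((Q *m e) i 0).
  by rewrite mxE; apply: eq_bigr => k _; rewrite linearZ /= [Q _ _]mxE mulrC.
by rewrite /e mulmxA mulmxVp // mul1mx mxE.
Qed.

End Height.

Section Lattice.
Variables (K : fieldType) (n : nat) (D : cartan_datum n) (q : q_param K).
Local Notation ratfun := {fraction {poly K}}.
Local Notation iota := (@ratfun_const K).
Local Notation A := (@localA K).
Local Notation pi := (uvar K - 1).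
Variables (V : lmodType ratfun) (M : rep (Uq D q) iota V).
Variables (W : set V) (hW : Mod_Uq'_form M W).
Local Notation weight := 'Hom(cartan_h D, rat^o).
Local Notation wt := (weight_space M).
Let hA := localA_dvr K.
Implicit Types (w : weight) (y z : V) (X : set V).

Definition lattice : set V := span_over A W.

Lemma lattice_submod : submod A lattice.
Proof. exact: (dvr_span_submod hA). Qed.

Lemma latticeZ a y : A a -> lattice y -> lattice (a *: y).
Proof. by have [_ _] := lattice_submod; apply. Qed.

Lemma span_form_graded P y : P 1 -> (forall a b, P a -> P b -> P (a * b)) ->
  span_over P W y -> span_over P [set z | exists w, (W `&` wt w) z] y.
Proof.
move=> P1 PM; apply: span_min; first exact: span_submod.
move=> {}y Wy; have [_ /(_ y Wy)[m [i [x [ix ->]]]] _] := modh_sum (form_modh hW).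
apply: (submod_sum (span_submod _ PM)) => j _; apply: span_subset => //.
by exists (i j); exact: (ix j).2.
Qed.

Lemma lattice_weight w y : lattice y -> wt w y -> span_over A (W `&` wt w) y.
Proof.
move=> Ly; apply: (@span_graded _ _ _ _ _ _ _ M _ (fun w => W `&` wt w)) => [w' z []//|].
by apply: span_form_graded; [exact: (dvr1 hA)|exact: (dvrM hA)|].
Qed.

Lemma form_spans y : span_over setT W y.
Proof. by have [-> _] := form_ext hW. Qed.

Lemma lattice_spans y : span_over setT lattice y.
Proof.
have [t [tW ->]] := form_spans y; exists t; split=> // p /tW[_ Wp].
by split=> //; exact: (dvr_span_subset hA).
Qed.

Lemma weight_span w y : wt w y -> span_over setT (W `&` wt w) y.
Proof.
apply: (@span_graded _ _ _ _ _ _ _ M _ (fun w => W `&` wt w)) => [w' z []//|].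
by apply: span_form_graded => //; exact: form_spans.
Qed.

Lemma weight_form_neq0 w y : wt w y -> y != 0 -> exists2 z, (W `&` wt w) z & z != 0.
Proof.
move=> /weight_span[t [tW ->]] y0; apply: contrapT => nW; case/eqP: y0.
rewrite big_seq big1 // => p pt; have [_ Wp] := tW p pt.
have [->|p0] := eqVneq p.2 0; first by rewrite scaler0.
by case: nW; exists p.2.
Qed.

Lemma lattice_weight_gens w :
  exists t : seq V, [set` t] `<=` W `&` wt w /\
    forall y, lattice y -> wt w y -> span_over A [set` t] y.
Proof.
have [t tW Wt] := modh_fin (form_modh hW) w; exists t; split=> // y Ly wy.
apply: span_min (lattice_weight Ly wy); first exact: (dvr_span_submod hA).
move=> z /Wt; apply: span_min; last exact: (dvr_span_subset hA).
apply: submod_weaken (dvr_span_submod hA _) => _ [c _ <-]; exact: localA_const.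
Qed.

(** With denominators bounded by [pi ^+ N], a submodule of a weight space lies in
    the span of the multiples by [pi ^- N] of the generators of that weight space
    of the lattice. *)
Lemma bounded_fin_gen w X N : submod A X -> X `<=` wt w ->
  (forall y, X y -> lattice (pi ^+ N *: y)) -> fin_gen A X.
Proof.
move=> hX Xw XN; have [t [_ tL]] := lattice_weight_gens w.
have piN0 : pi ^+ N != 0 by exact: (dvr_piX_neq0 hA).
apply: (@fin_gen_submod _ _ _ hA _ _ [seq (pi ^+ N)^-1 *: z | z <- t]) => // y Xy.
have [_ _ wZ] := weight_submod M setT w.
have := tL _ (XN _ Xy) (wZ _ _ I (Xw _ Xy)).
pose Y := [set z | span_over A [set` [seq (pi ^+ N)^-1 *: z | z <- t]] ((pi ^+ N)^-1 *: z)].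
rewrite -[in X in _ -> X](scalerK piN0 y); apply: (@span_min _ _ _ _ Y).
  apply: submod_scale_preim; exact: (dvr_span_submod hA).
by move=> z zt; apply: (dvr_span_subset hA); exact: map_f.
Qed.

Lemma lattice_h i m y : lattice y -> lattice (M (Uh D q i m) y).
Proof.
apply: (@span_min _ _ _ _ [set y | lattice (M (Uh D q i m) y)]).
  by apply: submod_act_preim; exact: lattice_submod.
move=> z Wz; have : span_over (@laurent K) W (M (Uh D q i m) z).
  apply: (form_hhat hW); first by apply: sub_gen_smallest; right; exists i => //; exists m.
  apply: span_subset => //; exists 1, 0%N; rewrite rmorph1 expr0 divr1 //.
apply: span_min; last exact: (dvr_span_subset hA).
by apply: submod_weaken lattice_submod; exact: laurent_localA.
Qed.

(** The quasi-polynomial dependence of [x_{i,r} z] on [r] confines its values to a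
    finitely generated module, whose generators have a common denominator.  The
    ratios [lambda * u ^+ k] of the quasi-polynomials are units of the local
    ring. *)
Lemma x_vector_bound s i w z : (W `&` wt w) z ->
  exists N, forall r, lattice (pi ^+ N *: M (Ux D q s i r) z).
Proof.
move=> Wz; have [t tx] : exists t : seq V, forall r, span_over A [set` t] (M (Ux D q s i r) z).
  apply: (quasi_poly_fin_gen hA (s := s)) => r.
  have [T [f [_ Tf TE]]] := form_x hW s w i r.
  exists [seq (iota t.2 * uvar K ^+ t.1.1, t.1.2, f t.1.1 t.1.2 t.2 z) | t <- T].
  split=> [_ /mapP[t tT ->] /=|m].
    have [|l0 _] := Tf t.1.1 t.1.2 t.2; first by move: tT; case: t => -[].
    apply: (unitAM hA).
      split; [by rewrite fmorph_eq0|exact: localA_const|].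
      rewrite -fmorphV; exact: localA_const.
    apply: (unitAX hA); split; first exact: uvar_neq0.
      exact: localA_poly.
    by apply: laurent_localA; exists 1, 1%N; rewrite rmorph1 mul1r expr1.
  rewrite TE // big_map; apply: eq_bigr => t _ /=.
  by rewrite exprMn exprM.
have [N tN] : exists N, forall y, y \in t -> lattice (pi ^+ N *: y).
  elim: t {tx} => [|y t [N tN]]; first by exists 0%N.
  have [N' yN'] := span_denominator hA lattice_submod (lattice_spans y).
  exists (N + N')%N => y'; rewrite inE => /orP[/eqP ->|/tN y'N].
    by rewrite exprD -scalerA; apply: latticeZ => //; exact: (dvr_piX hA).
  by rewrite exprD mulrC -scalerA; apply: latticeZ => //; exact: (dvr_piX hA).
exists N => r; move: (tx r).
apply: (@span_min _ _ _ _ [set y | lattice (pi ^+ N *: y)]) => //.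
exact: submod_scale_preim lattice_submod.
Qed.

Lemma lattice_mono N N' y : (N <= N')%N ->
  lattice (pi ^+ N *: y) -> lattice (pi ^+ N' *: y).
Proof.
move=> NN' yN; rewrite -(subnK NN') exprD -scalerA; apply: latticeZ => //.
exact: (dvr_piX hA).
Qed.

Lemma x_bound s i w : exists N, forall r y, lattice y -> wt w y ->
  lattice (pi ^+ N *: M (Ux D q s i r) y).
Proof.
have [t [tW tL]] := lattice_weight_gens w.
have [N tN] : exists N, forall z, z \in t -> forall r, lattice (pi ^+ N *: M (Ux D q s i r) z).
  elim: t {tL} tW => [|z t IH] tW; first by exists 0%N.
  have [z' z't|N tN] := IH; first by apply: tW; rewrite /= inE z't orbT.
  have [|N' zN'] := @x_vector_bound s i w z; first by apply: tW; rewrite /= inE eqxx.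
  exists (maxn N N') => z'; rewrite inE => /orP[/eqP ->|/tN z'N] r.
    exact: lattice_mono (leq_maxr _ _) (zN' r).
  exact: lattice_mono (leq_maxl _ _) (z'N r).
exists N => r y Ly wy; move: (tL _ Ly wy).
apply: (@span_min _ _ _ _ [set y | lattice (pi ^+ N *: M (Ux D q s i r) y)]).
  apply: (@submod_act_preim _ _ _ _ _ _ _ M _ [set y | lattice (pi ^+ N *: y)]).
  exact: submod_scale_preim lattice_submod.
by move=> z zt; exact: tN.
Qed.

End Lattice.

(** * Vectors generated from finitely many weight vectors *)

Lemma rat_bound (s : seq rat) : exists N : nat, forall a, a \in s -> a <= N%:R.
Proof.
elim: s => [|a s [N sN]]; first by exists 0%N.
exists (N + Num.bound `|a|)%N => b; rewrite inE => /orP[/eqP ->|/sN bN].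
  apply: le_trans (_ : (Num.bound `|a|)%:R <= _); last by rewrite ler_nat leq_addl.
  by apply: le_trans (ler_norm a) _; apply: ltW; exact: archi_boundP (normr_ge0 a).
by apply: le_trans bN _; rewrite ler_nat leq_addr.
Qed.

Section Levels.
Variables (K : fieldType) (n : nat) (D : cartan_datum n) (q : q_param K).
Local Notation ratfun := {fraction {poly K}}.
Local Notation iota := (@ratfun_const K).
Local Notation A := (@localA K).
Local Notation pi := (uvar K - 1).
Variables (V : lmodType ratfun) (M : rep (Uq D q) iota V).
Local Notation weight := 'Hom(cartan_h D, rat^o).
Local Notation wt := (weight_space M).
Let hA := localA_dvr K.
Implicit Types (w : weight) (y z : V) (X : set V) (G : weight -> set V).

Inductive h_closure X : set V :=
| h_closure_in y : X y -> h_closure X y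
| h_closure_h i m y : h_closure X y -> h_closure X (M (Uh D q i m) y).

Lemma h_closure_min X Y : X `<=` Y ->
  (forall i m y, Y y -> Y (M (Uh D q i m) y)) -> h_closure X `<=` Y.
Proof. by move=> XY Yh y; elim=> [z /XY|i m z _ /Yh]. Qed.

(** One operator [x^s_{i,r}] followed by any number of operators [h_{i,m}]; the
    family [G], and its image, are indexed by weights. *)
Definition step (s : bool) G w : set V := h_closure
  [set y | exists i r w' z, [/\ G w' z, w = w' + root D i *~ sgn s &
                              y = M (Ux D q s i r) z]].

Definition graded G := forall w, G w `<=` wt w.
Definition null G := forall w, G w `<=` [set 0].

Lemma step_graded s G : graded G -> graded (step s G).
Proof.
move=> hG w; apply: h_closure_min => [_ [i [r [w' [z [/hG wz -> ->]]]]]|i m y].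
  exact: weight_x.
exact: weight_h.
Qed.

Lemma step_null s G : null G -> null (step s G).
Proof.
move=> hG w; apply: h_closure_min => [_ [i [r [w' [z [/hG -> _ ->]]]]]|i m y ->].
  exact: act0.
exact: act0.
Qed.

Lemma iter_graded e s G : graded G -> graded (iter e (step s) G).
Proof. by move=> hG; elim: e => //= e; exact: step_graded. Qed.

Lemma iter_null e s G : null G -> null (iter e (step s) G).
Proof. by move=> hG; elim: e => //= e; exact: step_null. Qed.

Section Height.
Variables (rho : cartan_h D) (rootsE : forall i, root D i rho = 1).

Definition height w : rat := w rho.

Definition within (lo hi : rat) G :=
  forall w y, G w y -> y != 0 -> lo <= height w <= hi.

Lemma height_root w i s : height (w + root D i *~ sgn s) = height w + (sgn s)%:~R.
Proof.
rewrite /height add_lfunE; congr (_ + _); rewrite -(rootsE i).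
by case: s; rewrite /= ?mulr1z // mulrN1z opp_lfunE rootsE.
Qed.

Lemma step_within s lo hi G : within lo hi G ->
  within (lo + (sgn s)%:~R) (hi + (sgn s)%:~R) (step s G).
Proof.
move=> hG w; apply: h_closure_min => [_ [i [r [w' [z [Gz -> ->]]]]] y0|i m y IH y0].
  rewrite height_root !lerD2r; apply: hG Gz _.
  by apply: contra_neq y0 => ->; exact: act0.
by apply: IH; apply: contra_neq y0 => ->; exact: act0.
Qed.

Lemma iter_within e s lo hi G : within lo hi G ->
  within (lo + (sgn s)%:~R *+ e) (hi + (sgn s)%:~R *+ e) (iter e (step s) G).
Proof.
move=> hG; elim: e => [|e IH]; first by rewrite !addr0.
by rewrite !mulrSr !addrA; exact: step_within.
Qed.

End Height.

Variables (W : set V) (hW : Mod_Uq'_form M W).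
Local Notation lattice := (lattice W).

Definition bounded G := forall w, exists N, forall y, G w y -> lattice (pi ^+ N *: y).

Lemma h_closure_bounded N X : (forall y, X y -> lattice (pi ^+ N *: y)) ->
  forall y, h_closure X y -> lattice (pi ^+ N *: y).
Proof.
move=> XN; apply: (h_closure_min (Y := [set y | lattice (pi ^+ N *: y)])) => // i m y.
by rewrite /= -actZ; exact: lattice_h.
Qed.

(** For a given target weight, the source weight depends only on [i], which takes
    finitely many values, and [x_bound] is uniform in [r]. *)
Lemma step_bounded s G : graded G -> bounded G -> bounded (step s G).
Proof.
move=> gG bG w; pose w_ i := w - root D i *~ sgn s.
have /choice[N NP] : forall i, exists N, forall r z, G (w_ i) z ->
    lattice (pi ^+ N *: M (Ux D q s i r) z).
  move=> i; have [N1 GN1] := bG (w_ i); have [N2 xN2] := x_bound hW s i (w_ i).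
  exists (N2 + N1)%N => r z Gz; rewrite exprD -scalerA -actZ; apply: xN2.
    exact: GN1.
  by have [_ _ wZ] := weight_submod M setT (w_ i); apply: wZ => //; exact: gG.
exists (\max_i N i)%N; apply: h_closure_bounded => _ [i [r [w' [z [Gz wE ->]]]]].
apply: lattice_mono (leq_bigmax i) _; apply: NP.
by rewrite /w_ wE addrK.
Qed.

Lemma iter_bounded e s G : graded G -> bounded G -> bounded (iter e (step s) G).
Proof.
move=> gG bG; elim: e => //= e; apply: step_bounded; exact: iter_graded.
Qed.

Lemma height_bound rho : (forall i, root D i rho = 1) ->
  exists H : nat, forall w y, wt w y -> y != 0 -> height rho w <= H%:R.
Proof.
move=> rootsE; have [m [lam cone]] := modh_cone (form_modh hW).
have [H HP] := rat_bound [seq lam j rho | j <- enum 'I_m].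
exists H => w y wy y0; have [z Wz z0] := weight_form_neq0 hW wy y0.
have [|j [b ->]] := cone w; first by exists z.
apply: le_trans (HP _ (map_f _ (mem_enum _ j))).
rewrite /height add_lfunE opp_lfunE sum_lfunE gerDl oppr_le0.
apply: sumr_ge0 => i _; rewrite -scaler_nat scale_lfunE rootsE.
by rewrite scaler_nat; exact: ler0n.
Qed.

Section FiniteFamily.
Variable (s : seq (weight * V)).
Hypothesis s_wt : forall p, p \in s -> wt p.1 p.2.

Definition base w : set V := h_closure [set y | (w, y) \in s].

(** [d] operators [x^+], then [e] operators [x^-], interspersed with operators
    [h_{i,m}]. *)
Definition level e d : weight -> set V :=
  iter e (step false) (iter d (step true) base).

Lemma base_graded : graded base.
Proof.
move=> w; apply: h_closure_min => [y /s_wt//|i m y]; exact: weight_h.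
Qed.

Lemma base_bounded : bounded base.
Proof.
move=> w.
suff [N sN] : exists N, forall p, p \in s -> lattice (pi ^+ N *: p.2).
  by exists N; apply: h_closure_bounded => y /sN.
elim: s => [|p s' [N sN]]; first by exists 0%N.
have [N' pN'] := span_denominator hA (lattice_submod W) (lattice_spans hW p.2).
exists (maxn N N') => p'; rewrite inE => /orP[/eqP ->|/sN p'N].
  exact: lattice_mono (leq_maxr _ _) pN'.
exact: lattice_mono (leq_maxl _ _) p'N.
Qed.

Lemma level_graded e d : graded (level e d).
Proof. by do 2!apply: iter_graded; exact: base_graded. Qed.

(** Only finitely many pairs [(e, d)] reach a given weight.  The heights of the
    weights of [V] are at most [H] and those of the starting vectors are at least
    [- lo], so that [d] operators [x^+] give 0 as soon as [d > H + lo]; then the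
    height of [w] bounds [e]. *)
Lemma level_bounded w : exists N, forall e d y,
  level e d w y -> lattice (pi ^+ N *: y).
Proof.
have [rho rootsE] := exists_height D.
have [H HP] := height_bound rootsE.
have [lo loP] := rat_bound [seq - height rho p.1 | p <- s].
have [hi hiP] := rat_bound [seq height rho p.1 | p <- s].
have base_within : within rho (- lo%:R) hi%:R base.
  move=> w'; apply: h_closure_min => [y ys _|i m y IH y0].
    by rewrite lerNl (loP _ (map_f _ ys)) (hiP _ (map_f _ ys)).
  by apply: IH; apply: contra_neq y0 => ->; exact: act0.
have plus_within d := iter_within rootsE (e := d) (s := true) base_within.
have d_bound e d y : level e d w y -> y != 0 -> (d <= H + lo)%N.
  move=> Ly y0; rewrite leqNgt; apply/negP => Hd.
  suff h : null (iter d (step true) base).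
    by case/eqP: y0; exact: (iter_null (s := false) (e := e) h) Ly.
  move=> w' z Gz; apply: contrapT => /eqP z0.
  have /andP[] := plus_within d _ _ Gz z0.
  have gz := iter_graded (e := d) (s := true) base_graded Gz.
  move=> /le_trans /(_ (HP _ _ gz z0)) ; rewrite /= mulr1z addrC lerBlDr -natrD.
  by rewrite ler_nat leqNgt Hd.
have [E EP] := rat_bound [:: hi%:R + (H + lo)%:R - height rho w].
have e_bound e d y : level e d w y -> y != 0 -> (e <= E)%N.
  move=> Ly y0; rewrite -(ler_nat rat); apply: le_trans (EP _ (mem_head _ _)).
  have /andP[_] := iter_within rootsE (e := e) (s := false) (plus_within d) Ly y0.
  rewrite /= mulrN1z mulNrn lerBrDr -lerBrDl => /le_trans; apply.
  by rewrite lerD2r lerD2l ler_nat; exact: d_bound Ly y0.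
have lev_b e d : bounded (level e d).
  apply: iter_bounded; first by apply: iter_graded; exact: base_graded.
  by apply: iter_bounded; [exact: base_graded|exact: base_bounded].
have /choice[N NP] : forall ed : nat * nat, exists N, forall y,
    level ed.1 ed.2 w y -> lattice (pi ^+ N *: y) by move=> [e d]; exact: lev_b.
exists (\max_(e < E.+1) \max_(d < (H + lo).+1) N (e : nat, d : nat))%N => e d y Ly.
have [->|y0] := eqVneq y 0; first by rewrite scaler0; case: (lattice_submod W).
have eE : (e < E.+1)%N := e_bound _ _ _ Ly y0.
have dD : (d < (H + lo).+1)%N := d_bound _ _ _ Ly y0.
apply: lattice_mono (NP (e, d) y Ly).
apply: leq_trans (leq_bigmax (Ordinal eE)); exact: (leq_bigmax (Ordinal dD)).
Qed.

Definition levels : set V := span_over A [set y | exists w e d, level e d w y].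

Lemma levels_submod : submod A levels.
Proof. exact: (dvr_span_submod hA). Qed.

Lemma level_levels e d w y : level e d w y -> levels y.
Proof. by move=> Ly; apply: (dvr_span_subset hA); exists w, e, d. Qed.

Lemma levels_ind (a : Uq D q) :
  (forall e d w y, level e d w y -> levels (M a y)) ->
  forall y, levels y -> levels (M a y).
Proof.
move=> ha; apply: (@span_min _ _ _ _ [set y | levels (M a y)]).
  by apply: submod_act_preim; exact: levels_submod.
by move=> y [w [e [d /ha]]].
Qed.

Lemma stabilizer_subalgebra X : submod A X ->
  subalgebra [set a : Uq D q | forall y, X y -> X (M a y)].
Proof.
move=> [X0 XD XZ]; split=> /= [y|c a b Xa Xb y Xy|a b Xa Xb y Xy].
- by rewrite act1.
- rewrite act_addl act_scalel; apply: XD; last exact: Xb.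
  by apply: XZ; [exact: localA_const|exact: Xa].
- by rewrite actM; apply: Xa; exact: Xb.
Qed.

Lemma level_h e d w i m y : level e d w y -> level e d w (M (Uh D q i m) y).
Proof. by case: e => [|e]; [case: d => [|d]|]; exact: h_closure_h. Qed.

Lemma levels_k c y : levels y -> levels (M (Uk q c) y).
Proof.
apply: levels_ind => e d w {}y Ly; rewrite (level_graded Ly).
have [_ _ LZ] := levels_submod; apply: (LZ); first exact: localA_const.
exact: level_levels Ly.
Qed.

Lemma levels_h i m y : levels y -> levels (M (Uh D q i m) y).
Proof.
by apply: levels_ind => e d w {}y Ly; apply: level_levels; exact: level_h Ly.
Qed.

Lemma levels_hhat (a : free_alg K (gen D)) y :
  free_hhat a -> levels y -> levels (M (Uq_pi q a) y).
Proof.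
move=> Ha; move: y.
apply: (Ha [set a | forall y, levels y -> levels (M (Uq_pi q a) y)]); split.
  have [S1 SD SM] := stabilizer_subalgebra levels_submod.
  split=> /= [|c a' b Sa Sb|a' b Sa Sb].
  - exact: S1.
  - by rewrite Uq_piD Uq_piZ; exact: SD.
  - by rewrite Uq_piM; exact: SM.
by move=> _ [[c ->]|[i [m ->]]] y; [exact: levels_k|exact: levels_h].
Qed.

Lemma levels_xminus i r y : levels y -> levels (M (Ux D q false i r) y).
Proof.
apply: levels_ind => e d w {}y Ly.
apply: (@level_levels e.+1 d (w + root D i *~ sgn false)); apply: h_closure_in.
by exists i, r, w, y.
Qed.

(** The commutator of [x^+] with [x^-] is in the Cartan part, and that of [x^+]
    with [h] is a multiple of another [x^+], whence an induction on the number [e]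
    of operators [x^-], then on the number of operators [h] applied after the last
    of them. *)
Lemma levels_xplus i r y : levels y -> levels (M (Ux D q true i r) y).
Proof.
apply: levels_ind => e d w {}y Ly; move: Ly i r.
have [_ LD LZ] := levels_submod.
elim: e w y => [|e IH] w y.
  move=> Ly i r; apply: (@level_levels 0 d.+1 (w + root D i *~ sgn true)).
  by apply: h_closure_in; exists i, r, w, y.
move: y; apply: (h_closure_min
  (Y := [set y | forall i r, levels (M (Ux D q true i r) y)])).
  move=> _ [j [t [w' [z [Lz _ ->]]]]] i r.
  have [a Ha xx] := Uq_xx D q i r j t.
  rewrite -actM xx act_addl actM; apply: (LD).
    by apply: levels_xminus; exact: IH Lz _ _.
  by apply: levels_hhat Ha _; exact: level_levels Lz.
move=> j m y Ly i r; have [c hx] := Uq_hx D q true j m i r.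
have -> : M (Ux D q true i r) (M (Uh D q j m) y) =
    M (Uh D q j m) (M (Ux D q true i r) y) + (-1) *: (iota c *: M (Ux D q true i (val m + r)) y).
  by rewrite -!actM hx act_addl act_scalel scaleN1r addrK.
apply: (LD); first exact: levels_h.
apply: (LZ); first by apply: (dvrN hA); exact: (dvr1 hA).
by apply: (LZ); [exact: localA_const|exact: Ly].
Qed.

Lemma levels_stable a y : levels y -> levels (M a y).
Proof.
move: a y; apply: Uq_ind; first exact: stabilizer_subalgebra levels_submod.
- by move=> [] i r y; [exact: levels_xplus|exact: levels_xminus].
- by move=> c y; exact: levels_k.
- by move=> i m y; exact: levels_h.
Qed.

Lemma orbit_levels : Uqu_orbit M (\sum_(p <- s) p.2) `<=` levels.
Proof.
move=> _ [t At <-]; apply: (submod_sum levels_submod) => p pt.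
have [_ _ LZ] := levels_submod; apply: (LZ); first exact: At.
apply: levels_stable; apply: (submod_sum levels_submod) => p' p's.
by apply: (@level_levels 0 0 p'.1); apply: h_closure_in; rewrite /= -surjective_pairing.
Qed.

(** The part of weight [w] of the span of all the levels is the span of their parts
    of weight [w], which have a common denominator. *)
Lemma levels_bounded w : exists N, forall y, levels y -> wt w y -> lattice (pi ^+ N *: y).
Proof.
have [N LN] := level_bounded w; exists N => y Ly wy.
pose S w' : set V := [set z | exists e d, level e d w' z].
have SV w' : S w' `<=` wt w' by move=> z [e [d]]; exact: level_graded.
move: (span_graded (S := S) SV Ly wy).
apply: (@span_min _ _ _ _ [set z | lattice (pi ^+ N *: z)]).
  exact: submod_scale_preim (lattice_submod W).
by move=> z [e [d]]; exact: LN.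
Qed.

End FiniteFamily.

End Levels.

(** * Specialization at u = 1 *)

Section Specialization.
Variables (K : fieldType) (n : nat) (D : cartan_datum n) (q : q_param K).
Local Notation ratfun := {fraction {poly K}}.
Local Notation iota := (@ratfun_const K).
Local Notation A := (@localA K).
Local Notation pi := (uvar K - 1).
Variables (V : lmodType ratfun) (M : rep (Uq D q) iota V).
Local Notation weight := 'Hom(cartan_h D, rat^o).
Local Notation wt := (weight_space M).
Let hA := localA_dvr K.
Variables (Mt : set V) (Mt_sub : submod A Mt).
Hypothesis Mt_stable : forall a v, Mt v -> Mt (M a v).
Implicit Types (w : weight) (y z : V).

Local Notation S := (spec_mod Mt_sub).
Local Notation SM := (spec_rep Mt_sub Mt_stable).

(** The class map, extended by 0 so as to be free of membership proofs. *)
Definition spec_cl y : S :=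
  if pselect (Mt y) is left My then spec_class Mt_sub My else 0.

Lemma spec_classE y (My : Mt y) : spec_class Mt_sub My = spec_cl y.
Proof.
rewrite /spec_cl; case: pselect => // My'; congr (quo_pi _ _).
exact: val_inj.
Qed.

Lemma spec_clP (x : S) : exists2 y, Mt y & x = spec_cl y.
Proof.
move: x; elim/quo_ind => x; exists (val x); first exact: sub_modP.
rewrite -(spec_classE (sub_modP x)); congr (quo_pi _ _); exact: val_inj.
Qed.

Lemma spec_clD y z : Mt y -> Mt z -> spec_cl (y + z) = spec_cl y + spec_cl z.
Proof.
move=> My Mz; have [_ MD _] := Mt_sub.
rewrite -(spec_classE My) -(spec_classE Mz) -(spec_classE (MD _ _ My Mz)).
rewrite -[RHS]quo_piD; congr (quo_pi _ _); exact: val_inj.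
Qed.

Lemma spec_clZ c y : Mt y -> spec_cl (iota c *: y) = c *: spec_cl y.
Proof.
move=> My; have [_ _ MZ] := Mt_sub.
rewrite -(spec_classE My) -(spec_classE (MZ _ _ (localA_const c) My)).
rewrite -[RHS]/(quo_scale c (quo_pi _ _)) quo_scaleE.
congr (quo_pi _ _); exact: val_inj.
Qed.

Lemma spec_cl_act a y : Mt y -> spec_cl (M a y) = SM a (spec_cl y).
Proof.
move=> My; rewrite -(spec_classE My) -(spec_classE (Mt_stable a My)).
rewrite [RHS](quo_actE _ (lattice_u1_stable Mt_stable)).
congr (quo_pi _ _); exact: val_inj.
Qed.

Lemma spec_cl_eq0 y : Mt y -> spec_cl y = 0 <-> exists2 z, Mt z & y = pi *: z.
Proof.
move=> My; set y' := sub_mk (localA_submod_const Mt_sub) My.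
have pi0 : quo_pi (lattice_u1_sub Mt_sub) 0 = 0.
  by apply: (addrI (quo_pi (lattice_u1_sub Mt_sub) 0)); rewrite -quo_piD !addr0.
have E : spec_cl y = 0 <-> lattice_u1 y'.
  rewrite -(spec_classE My) -pi0 -[y' in lattice_u1 y']subr0.
  exact: quo_pi_eq.
split=> [/E[z zE]|[z Mz yE]]; first by exists (val z) => //; exact: sub_modP.
by apply/E; exists (sub_mk (localA_submod_const Mt_sub) Mz).
Qed.

Lemma spec_cl0 : spec_cl 0 = 0.
Proof.
have [M0 _ _] := Mt_sub; apply/(spec_cl_eq0 M0).
by exists 0; rewrite ?scaler0.
Qed.

Lemma spec_cl_sum (I : eqType) (r : seq I) (F : I -> V) :
  (forall i, i \in r -> Mt (F i)) ->
  spec_cl (\sum_(i <- r) F i) = \sum_(i <- r) spec_cl (F i).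
Proof.
elim: r => [|i r IH] MF; first by rewrite !big_nil spec_cl0.
have Mr j : j \in r -> Mt (F j) by move=> jr; apply: MF; rewrite inE jr orbT.
rewrite !big_cons spec_clD ?IH //; last exact: submod_sum Mt_sub Mr.
by apply: MF; rewrite inE eqxx.
Qed.

(** The local ring acts on the specialization through its residue field [K], so
    that [K]-subspaces have [A]-submodules as preimages. *)
Lemma spec_preim_submod (Z : set S) : submod setT Z ->
  submod A [set y | Mt y /\ Z (spec_cl y)].
Proof.
move=> [Z0 ZD ZZ]; have [M0 MD MZ] := Mt_sub.
split=> [|x y [Mx Zx] [My Zy]|a x Aa [Mx Zx]].
- by split; rewrite ?spec_cl0.
- by split; [exact: MD|rewrite spec_clD //; exact: ZD].
- split; first exact: MZ.
  have [c [b [Ab ->]]] := localA_residue Aa.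
  have Mb : Mt (b *: x) by exact: MZ.
  have Mpb : Mt (pi *: (b *: x)) by apply: MZ => //; exact: localA_uvar1.
  rewrite scalerDl -scalerA spec_clD //; last by apply: MZ => //; exact: localA_const.
  rewrite (_ : spec_cl (pi *: _) = 0) ?addr0 ?spec_clZ //; first exact: ZZ.
  by apply/spec_cl_eq0 => //; exists (b *: x).
Qed.

Lemma spec_weight w y : Mt y -> wt w y -> weight_space SM w (spec_cl y).
Proof. by move=> My wy c; rewrite -spec_cl_act // wy spec_clZ. Qed.

Hypothesis Mt_graded : forall y, Mt y -> exists s : seq (weight * V),
  (forall p, p \in s -> wt p.1 p.2 /\ Mt p.2) /\ y = \sum_(p <- s) p.2.

(** The images of the weight spaces of [Mt] lie in the weight spaces of the
    specialization and span it; as the latter are independent, they can be no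
    larger. *)
Lemma spec_weight_lift w x :
  weight_space SM w x -> exists y, [/\ Mt y, wt w y & x = spec_cl y].
Proof.
move=> wx; have [M0 MD MZ] := Mt_sub.
pose Z w := [set x | exists y, [/\ Mt y, wt w y & x = spec_cl y]].
have ZS w' : Z w' `<=` weight_space SM w' by move=> _ [y [My wy ->]]; exact: spec_weight.
have Zsub w' : submod setT (Z w').
  have [w0 wD wZ] := weight_submod M setT w'.
  split=> [|_ _ [y [My wy ->]] [z [Mz wz ->]]|c _ _ [y [My wy ->]]].
  - by exists 0; rewrite spec_cl0.
  - by exists (y + z); rewrite spec_clD //; split; [exact: MD|exact: wD|].
  - exists (iota c *: y); rewrite spec_clZ //; split=> //; last exact: wZ.
    by apply: MZ => //; exact: localA_const.
suff : span_over setT (Z w) x by exact: span_min (Zsub w) _ _.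
apply: (span_graded ZS) wx.
have [y My ->] := spec_clP x; have [s [sM ->]] := Mt_graded My.
rewrite spec_cl_sum; last by move=> p /sM[].
apply: submod_sum; first exact: span_submod.
move=> p /sM[wp Mp]; apply: span_subset => //.
by exists p.1, p.2.
Qed.

Variables (W : set V) (hW : Mod_Uq'_form M W).
Hypothesis Mt_fin : forall w, fin_gen A (Mt `&` wt w).

Lemma spec_weight_eq0 w : (forall z, (W `&` wt w) z -> z = 0) ->
  setT `&` weight_space SM w = [set 0].
Proof.
move=> W0; apply/seteqP; split=> [x [_ /spec_weight_lift[y [My wy ->]]]|_ ->] /=.
  have [->|y0] := eqVneq y 0; first exact: spec_cl0.
  by have [z /W0 -> ] := weight_form_neq0 hW wy y0; rewrite eqxx.
by split=> //; case: (weight_submod SM setT w).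
Qed.

Lemma spec_in_Mod_Uq : in_Mod_Uq SM.
Proof.
split=> //.
- split=> [w _ x []//|x _|m i x i_inj ix x0].
    have [y My ->] := spec_clP x; have [s [sM ->]] := Mt_graded My.
    pose t := in_tuple s.
    exists (size s), (fun j => (tnth t j).1), (fun j => spec_cl (tnth t j).2); split.
      move=> j; have [wj Mj] := sM _ (mem_tnth j t).
      by split=> //; split=> //; exact: spec_weight.
    by rewrite spec_cl_sum => [|p /sM[]//]; rewrite [LHS]big_tnth.
  apply: (weight_independent i_inj) x0 => j; exact: (ix j).2.2.
- move=> w; have [t tM Mt_t] := Mt_fin w.
  exists [seq spec_cl y | y <- t].
    move=> _ /mapP[y /tM[My wy] ->]; split=> //; exact: spec_weight.
  move=> _ [_ /spec_weight_lift[y [My wy ->]]].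
  pose Z := span_over (range (idfun : K -> K)) [set` [seq spec_cl y | y <- t]].
  have Z_sub : submod setT Z.
    apply: (@submod_weaken _ _ _ (range (idfun : K -> K))) => [c _|]; first by exists c.
    by apply: span_submod => a b _ _; exists (a * b).
  suff [] : [set y | Mt y /\ Z (spec_cl y)] y by [].
  apply: (span_min (spec_preim_submod Z_sub)) (Mt_t _ (conj My wy)) => z zt.
  split; first by have [] := tM _ zt.
  by apply: span_subset; [exists 1|exact: map_f].
- have [m [lam cone]] := modh_cone (form_modh hW).
  exists m, lam => w [_ [_ /spec_weight_lift[y [My wy ->]]] x0].
  apply: cone; apply: (weight_form_neq0 hW wy).
  by apply: contra_neq x0 => ->; exact: spec_cl0.
- move=> w i; have [R hR] := modh_nil (form_modh hW) w i.
  exists R => r /hR[W1 W2]; split; apply: spec_weight_eq0 => z.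
    by rewrite W1.
  by rewrite W2.
Qed.

(** Otherwise all weight spaces of [Mt] would be divisible by [u - 1], hence zero
    by Nakayama's lemma. *)
Lemma spec_neq0 v : Mt v -> v != 0 -> exists x : S, x != 0.
Proof.
move=> Mv v0; apply: contrapT => S0.
have [s [sM vE]] := Mt_graded Mv; case/eqP: v0; rewrite vE.
rewrite big_seq big1 // => p /sM[wp Mp].
have hX : submod A (Mt `&` wt p.1) by apply: submodI => //; exact: weight_submod.
apply: (nakayama hA hX (Mt_fin _)) => // y [My wy].
have [z Mz yE] : exists2 z, Mt z & y = pi *: z.
  apply/spec_cl_eq0 => //; apply: contrapT => /eqP y0; apply: S0.
  by exists (spec_cl y).
exists z => //; split=> //.
have [_ _ wZ] := weight_submod M setT p.1.
rewrite -[z](scalerK (uvar1_neq0 K)) -yE; exact: wZ.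
Qed.

End Specialization.

(** * The module generated by a vector *)

Section Orbit.
Variables (K : fieldType) (n : nat) (D : cartan_datum n) (q : q_param K).
Local Notation ratfun := {fraction {poly K}}.
Local Notation iota := (@ratfun_const K).
Local Notation A := (@localA K).
Variables (V : lmodType ratfun) (M : rep (Uq D q) iota V).
Variables (W : set V) (hW : Mod_Uq'_form M W) (v : V).
Local Notation weight := 'Hom(cartan_h D, rat^o).
Local Notation wt := (weight_space M).
Let hA := localA_dvr K.

Lemma weight_decomposition y : exists s : seq (weight * V),
  (forall p, p \in s -> wt p.1 p.2) /\ y = \sum_(p <- s) p.2.
Proof.
have [//|t [tW yE]] := @span_form_graded K n D q V M W hW setT y I _ (form_spans hW y).
have /choice[g gW] : forall p : ratfun * V, exists w, p \in t -> (W `&` wt w) p.2.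
  move=> p; have [pt|pt] := boolP (p \in t); last by exists 0.
  by have [_ [w ww]] := tW p pt; exists w.
exists [seq (g p, p.1 *: p.2) | p <- t]; split; last by rewrite big_map.
move=> _ /mapP[p pt ->] /=; have [_ _ wZ] := weight_submod M setT (g p).
by apply: wZ => //; exact: (gW p pt).2.
Qed.

Lemma orbit_graded y : Uqu_orbit M v y -> exists s : seq (weight * V),
  (forall p, p \in s -> wt p.1 p.2 /\ Uqu_orbit M v p.2) /\ y = \sum_(p <- s) p.2.
Proof.
have [s [s_wt ->]] := weight_decomposition y => Oy.
have [s' [s'O ->]] := weight_components (@Uqu_orbit_stable _ _ _ _ _ M v) s_wt Oy.
by exists s'.
Qed.

Lemma orbit_fin_gen w : fin_gen A (Uqu_orbit M v `&` wt w).
Proof.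
have [s [s_wt vE]] := weight_decomposition v.
have [N levN] := levels_bounded hW s_wt w.
apply: (bounded_fin_gen hW (w := w) (N := N)) => [|y []//|y [Oy wy]].
  by apply: submodI; [exact: Uqu_orbit_submod|exact: weight_submod].
by apply: levN => //; apply: (orbit_levels s_wt); rewrite -vE.
Qed.

Lemma orbit_act a : Uqu_orbit M v (M a v).
Proof. by apply: Uqu_orbit_stable; exact: Uqu_orbit_self. Qed.

Lemma orbit_A_form : A_form M (Uq'_orbit M v) (Uqu_orbit M v).
Proof.
have O_sub := Uqu_orbit_submod M v.
have ON : Uqu_orbit M v `<=` Uq'_orbit M v by move=> _ [t _ <-]; exists t.
split=> //.
- move=> t y At Oy; apply: (submod_sum O_sub) => p /At Ap.
  have [_ _ OZ] := O_sub; apply: OZ => //; exact: Uqu_orbit_stable.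
- apply/seteqP; split.
    apply: span_min ON; split; first by exists [::] => //; rewrite /tensor_act big_nil.
    + by move=> _ _ [t _ <-] [t' _ <-]; exists (t ++ t') => //; rewrite /tensor_act big_cat.
    + move=> a _ _ [t _ <-]; exists [seq (a * p.1, p.2) | p <- t] => //.
      by rewrite /tensor_act big_map scaler_sumr; apply: eq_bigr => p _; rewrite scalerA.
  move=> _ [t _ <-]; have hT : submod setT (span_over setT (Uqu_orbit M v)) by exact: span_submod.
  apply: (submod_sum hT) => p _; have [_ _ TZ] := hT; apply: TZ => //.
  by apply: span_subset => //; exact: orbit_act.
- by move=> w; rewrite setIA (setIidl ON); exact: orbit_fin_gen.
Qed.

(** The classes in [Uq] times that of [v] form a [K]-subspace; its preimage is an
    [A]-submodule that contains the [M a v], hence all of the orbit. *)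
Lemma orbit_spec_cyclic (x : orbit_spec_mod M v) :
  exists a, x = orbit_spec M v a (orbit_spec_gen M v).
Proof.
have Ov := @Uqu_orbit_self _ _ _ _ _ M v.
rewrite /orbit_spec_gen spec_classE.
pose Z := [set x : orbit_spec_mod M v | exists a,
  x = orbit_spec M v a (spec_cl (Uqu_orbit_submod M v) v)].
have Z_sub : submod setT Z.
  split=> [|_ _ [a ->] [b ->]|c _ _ [a ->]].
  - by exists (0 *: 1); rewrite act_scalel scale0r.
  - by exists (a + b); rewrite act_addl.
  - by exists (c *: a); rewrite act_scalel.
have [y Oy ->] := spec_clP x; suff [_ //] : [set y | Uqu_orbit M v y /\ Z (spec_cl _ y)] y.
case: Oy => t At <-; apply: (submod_sum (spec_preim_submod Z_sub)) => p pt.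
have [_ _ PZ] := spec_preim_submod Z_sub; apply: PZ; first exact: At.
split; first exact: orbit_act.
by exists p.2; rewrite (spec_cl_act (Uqu_orbit_submod M v) (@Uqu_orbit_stable _ _ _ _ _ M v)).
Qed.

End Orbit.

Theorem theorem4p6 (R : realType) (n : nat) (D : cartan_datum n)
    (q : q_param R[i]) (V : lmodType {fraction {poly R[i]}})
    (M : rep (Uq D q) (@ratfun_const R[i]) V) (HM : in_Mod_Uq' M)
    (v : V) (v_neq0 : v != 0) :
  [/\ A_form M (Uq'_orbit M v) (Uqu_orbit M v),
      in_Mod_Uq (orbit_spec M v),
      exists x : orbit_spec_mod M v, x != 0 &
      forall x : orbit_spec_mod M v,
        exists a : Uq D q, x = orbit_spec M v a (orbit_spec_gen M v)].
Proof.
have [W hW] := HM.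
have graded := @orbit_graded _ _ _ _ _ M W hW v.
have fin := @orbit_fin_gen _ _ _ _ _ M W hW v.
split.
- exact: orbit_A_form hW v.
- exact: (spec_in_Mod_Uq _ (@Uqu_orbit_stable _ _ _ _ _ M v) graded hW fin).
- exact: (spec_neq0 (Uqu_orbit_submod M v) graded fin (Uqu_orbit_self M v) v_neq0).
- exact: orbit_spec_cyclic.
Qed.
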